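(* Let $r,s,a,b\ge0$ be integers with $rs-ab=1$, and let $\Phi\left(\begin{smallmatrix} r&a\\ b&s\end{smallmatrix}\right)$ be the associated fan, with monomials $x_0,\dots,x_k,y_0,\dots,y_l$ and tags $a_0,\dots,a_k$, $b_0,\dots,b_l$. If $a_0=0$ and $b_0<0$ then $[a_2,\dots,a_k,b_l,\dots,b_2,b_1]=0$. If $a_0<0$ and $b_0=0$ then $[a_1,\dots,a_k,b_l,\dots,b_2]=0$. Conversely, given cyclic quotient singularities $\frac1r(\alpha,1)$ and $\frac1s(\beta,1)$, let $T$ be the tent with $S_1=\frac1r(\alpha,1)$, $S_3=\frac1s(\beta,1)$. Then $T$ is given by a fan $\Phi\left(\begin{smallmatrix} r&a\\ b&s\end{smallmatrix}\right)$ with big end $S_0=\mathbb A^2_{\langle x_0,y_0\rangle}$ (that is, with $a,b\ge0$ and $rs-ab=1$) if and only if the continued fractions $$\frac r{r-\alpha}=[a_{k-1},\dots,a_1]\quad\text{and}\quad \frac s{s-\beta}=[b_{l-1},\dots,b_1]$$ (with all entries $\ge2$) can be concatenated with integers $a_k,b_l\ge0$ such that $$\text{either } [a_2,\dots,a_k,b_l,\dots,b_2,b_1]=0\quad\text{or}\quad [a_1,a_2,\dots,a_k,b_l,\dots,b_2]=0.$$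
   Context: Continued fractions: $[c_1,\dots,c_n]=c_1-1/(c_2-1/(\cdots-1/c_n))$. For integers $c_i$ write $\prod_{i=1}^n\left(\begin{smallmatrix}0&1\\-1&c_i\end{smallmatrix}\right)=\left(\begin{smallmatrix}-q'&q\\-p'&p\end{smallmatrix}\right)$, so that $[c_1,\dots,c_n]=p/q$; the equality $[c_1,\dots,c_n]=0$ means $p=0$. Empty continued fractions correspond to $r=1$ (respectively $s=1$), with $k=1$ (respectively $l=1$). Cyclic quotients: $\frac1r(\alpha,1)$ ($\alpha$ coprime to $r$, $0<\alpha<r$ if $r\ge2$, and $\alpha=0$ if $r=1$) is $\mathbb A^2_{\langle u,v\rangle}/(\mathbb Z/r)$ for $(u,v)\mapsto(\varepsilon^\alpha u,\varepsilon v)$, $\varepsilon$ a primitive $r$th root of 1. Its coordinate ring is minimally generated by the invariant monomials on the Newton boundary, ordered from $x_0=u^r$ to $x_k=v^r$. Tent: $T=S_0\cup S_1\cup S_2\cup S_3\subset\mathbb A^{k+l+2}_{\langle x_0,\dots,x_k,y_0,\dots,y_l\rangle}$, where $S_1=\frac1r(\alpha,1)$ has generators $x_0,\dots,x_k$ (its minimal generating invariant monomials on the Newton boundary, ordered from $x_0=u^r$ to $x_k=v^r$) and $S_3=\frac1s(\beta,1)$ has generators $y_0,\dots,y_l$ (likewise the minimal generating monomials on the Newton boundary invariant under the $\mathbb Z/s$ action of type $\frac1s(\beta,1)$, ordered from $y_0=u^s$ to $y_l=v^s$), is defined by the ideals of $S_1$, $S_3$ and $x_iy_j=0$ for $(i,j)\ne(0,0),(k,l)$;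 $S_0=\mathbb A^2_{\langle x_0,y_0\rangle}$, $S_2=\mathbb A^2_{\langle x_k,y_l\rangle}$. Fan: for $r,s,a,b\ge0$ with $rs-ab=1$, let $\overline{\mathbb M}\cong\mathbb Z^2$ (written multiplicatively) have basis $\eta,\xi$, and put $x_0=\eta^{-r}\xi^a$, $y_0=\eta^b\xi^{-s}$. The fan $\Phi\left(\begin{smallmatrix} r&a\\ b&s\end{smallmatrix}\right)$ divides the plane into the four cones $\langle x_0,y_0\rangle$, $\langle x_0,\xi\rangle$, $\langle\xi,\eta\rangle$, $\langle y_0,\eta\rangle$. Let $x_0,x_1,\dots,x_k=\xi$ be the successive minimal generators of the monoid $\overline{\mathbb M}\cap\langle x_0,\xi\rangle$, and $y_0,y_1,\dots,y_l=\eta$ those of $\overline{\mathbb M}\cap\langle y_0,\eta\rangle$. The tags are the integers in $x_{i-1}x_{i+1}=x_i^{a_i}$ ($1\le i\le k-1$), $y_{j-1}y_{j+1}=y_j^{b_j}$ ($1\le j\le l-1$), and at the corners $x_1y_0=x_0^{a_0}$, $x_0y_1=y_0^{b_0}$, $x_{k-1}\eta=\xi^{a_k}$, $y_{l-1}\xi=\eta^{b_l}$. The tent is given by the fan if its coordinate ring is the ring with basis the lattice points of $\overline{\mathbb M}$, with product $m_1m_2$ if $m_1,m_2$ lie in a common cone of the fan and $0$ otherwise, compatibly with the labels $x_i,y_j$. The choice of signs gives $-\langle\xi,\eta\rangle\subseteq\langle x_0,y_0\rangle$, expressed by saying that $S_0$ is the big end. *)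

(* Defs.v *)
From mathcomp Require Export all_boot all_order all_algebra.
From mathcomp Require Export mpoly.

Set Implicit Arguments.
Unset Strict Implicit.
Unset Printing Implicit Defensive.

Import Order.TTheory GRing.Theory Num.Theory.
Local Open Scope ring_scope.

(** * Continued fractions *)

Definition cf_step (c : int) : 'M[int]_2 :=
  \matrix_(i < 2, j < 2)
     if i == ord0 then (if j == ord0 then 0 else 1)
     else (if j == ord0 then - 1 else c).

(* The matrix (-q' q; -p' p); matrix multiplication is the ring product. *)
Definition cf_mx (cs : seq int) : 'M[int]_2 := \prod_(c <- cs) cf_step c.

Definition cf_num (cs : seq int) : int := cf_mx cs ord_max ord_max.
Definition cf_den (cs : seq int) : int := cf_mx cs ord0 ord_max.

Definition cfrac (cs : seq int) : rat := (cf_num cs)%:~R / (cf_den cs)%:~R.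

(* The equality [c_1, ..., c_n] = 0 is about the numerator only: the
   denominator may vanish for the intermediate continued fractions. *)
Definition cf_is_zero (cs : seq int) : Prop := cf_num cs = 0.

(* r / q = [c_1, ..., c_n] with all entries >= 2; the empty continued fraction
   (for which the matrix gives 1 / 0) is by convention the expansion attached
   to r = 1, where q = 1. *)
Definition cf_expansion (r q : nat) (cs : seq int) : Prop :=
  all (fun c => 2 <= c) cs /\
  (if cs is [::] then r = 1%N else (r%:R / q%:R : rat) = cfrac cs).

(* [:: a_m; ...; a_n], empty when n < m, and the same list reversed *)
Definition upto (a : nat -> int) (m n : nat) : seq int :=
  [seq a i | i <- index_iota m n.+1].
Definition downto (a : nat -> int) (n m : nat) : seq int := rev (upto a m n).

(** * Monoids and cones *)

Definition generates (V : nmodType) (M : V -> Prop) (g : seq V) : Prop :=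
  (forall v, v \in g -> M v) /\
  (forall v, M v -> exists c : nat -> nat, v = \sum_(i < size g) g`_i *+ c i).

Definition minimal_generators (V : nmodType) (M : V -> Prop) (g : seq V) :
    Prop :=
  generates M g /\ (forall g', subseq g' g -> generates M g' -> g' = g).

(* The lattice of Laurent monomials, written additively:
   (i, j) stands for eta^i xi^j. *)
Notation lattice := (int * int)%type.

Definition eta : lattice := (1, 0).
Definition xi : lattice := (0, 1).

(* Lattice points of the cone spanned by v and w over the nonnegative
   rationals, after clearing denominators. *)
Definition cone (v w m : lattice) : Prop :=
  exists n i j : nat, (0 < n)%N /\ m *+ n = v *+ i + w *+ j.

Definition wedge (v w : lattice) : int := v.1 * w.2 - v.2 * w.1.

(** * The fan Phi (r a; b s) *)

Definition fan_matrix (r a b s : nat) : Prop :=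
  r%:Z * s%:Z - a%:Z * b%:Z = 1.

Definition fan_x0 (r a : nat) : lattice := (- r%:Z, a%:Z).
Definition fan_y0 (b s : nat) : lattice := (b%:Z, - s%:Z).

Definition common_cone (r a b s : nat) (m m' : lattice) : Prop :=
  let x0 := fan_x0 r a in
  let y0 := fan_y0 b s in
  [\/ cone x0 y0 m /\ cone x0 y0 m',
      cone x0 xi m /\ cone x0 xi m',
      cone xi eta m /\ cone xi eta m'
    | cone y0 eta m /\ cone y0 eta m'].

(* x = (x_0, ..., x_k) runs clockwise from x_0 to xi, and y = (y_0, ..., y_l)
   counterclockwise from y_0 to eta. *)
Definition fan_monomials (r a b s k l : nat)
    (x : k.+1.-tuple lattice) (y : l.+1.-tuple lattice) : Prop :=
  [/\ minimal_generators (cone (fan_x0 r a) xi) x,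
      [/\ x`_0 = fan_x0 r a, x`_k = xi
        & sorted [rel v w | wedge v w < 0] x],
      minimal_generators (cone (fan_y0 b s) eta) y
    & [/\ y`_0 = fan_y0 b s, y`_l = eta
        & sorted [rel v w | 0 < wedge v w] y]].

Definition fan_tags (k l : nat)
    (x : k.+1.-tuple lattice) (y : l.+1.-tuple lattice)
    (a b : nat -> int) : Prop :=
  [/\ (forall i, (0 < i < k)%N -> x`_i.-1 + x`_i.+1 = x`_i *~ a i),
      (forall j, (0 < j < l)%N -> y`_j.-1 + y`_j.+1 = y`_j *~ b j),
      x`_1 + y`_0 = x`_0 *~ a 0%N /\ x`_0 + y`_1 = y`_0 *~ b 0%N
    & x`_k.-1 + eta = xi *~ a k /\ y`_l.-1 + xi = eta *~ b l].

(** * Cyclic quotient singularities *)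

Definition cyclic_quotient_type (r alpha : nat) : Prop :=
  [/\ (0 < r)%N, coprime alpha r, ((2 <= r)%N -> (0 < alpha < r)%N)
    & (r = 1%N -> alpha = 0%N)].

Section CyclicQuotient.
Variable K : fieldType.

Definition var_u : {mpoly K[2]} := 'X_(ord0 : 'I_2).
Definition var_v : {mpoly K[2]} := 'X_(ord_max : 'I_2).

Definition cyclic_action (eps : K) (alpha : nat) (p : {mpoly K[2]}) :
    {mpoly K[2]} :=
  p \mPo [tuple eps ^+ alpha *: var_u; eps *: var_v].

Definition monomial (e : nat * nat) : {mpoly K[2]} :=
  var_u ^+ e.1 * var_v ^+ e.2.

Definition invariant_monomial (eps : K) (alpha : nat) (e : nat * nat) : Prop :=
  cyclic_action eps alpha (monomial e) = monomial e.

(* Exponents of the generators of the coordinate ring of 1/r (alpha, 1),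
   ordered by decreasing power of u from u^r to v^r. *)
Definition quotient_generators (r alpha : nat) (eps : K) (k : nat)
    (e : k.+1.-tuple (nat * nat)) : Prop :=
  minimal_generators (invariant_monomial eps alpha) e /\
  [/\ e`_0 = (r, 0%N), e`_k = (0%N, r)
    & sorted [rel d d' | (d'.1 < d.1)%N] e].

(* Relations between the chosen generators of the ring of invariants, i.e. the
   ideal of 1/r (alpha, 1) in affine (k+1)-space. *)
Definition quotient_ideal (k : nat) (e : k.+1.-tuple (nat * nat))
    (p : {mpoly K[k.+1]}) : Prop :=
  p \mPo [tuple monomial (tnth e i) | i < k.+1] = 0.

End CyclicQuotient.

(** * Tents *)

Section Tent.
Variable K : fieldType.

Definition ideal_generated (R : comNzRingType) (P : R -> Prop) (f : R) : Prop :=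
  exists n (c g : 'I_n -> R), (forall i, P (g i)) /\ f = \sum_(i < n) c i * g i.

Variables (k l : nat).
Local Notation P := {mpoly K[k.+1 + l.+1]}.

Definition tent_x (i : 'I_k.+1) : P := 'X_(lshift l.+1 i).
Definition tent_y (j : 'I_l.+1) : P := 'X_(rshift k.+1 j).

Variables (e : k.+1.-tuple (nat * nat)) (f : l.+1.-tuple (nat * nat)).

Definition tent_equation (p : P) : Prop :=
  [\/ exists2 q : {mpoly K[k.+1]},
        quotient_ideal e q & p = q \mPo [tuple tent_x i | i < k.+1],
      exists2 q : {mpoly K[l.+1]},
        quotient_ideal f q & p = q \mPo [tuple tent_y j | j < l.+1]
    | exists i j,
        [/\ (i, j) != (ord0, ord0), (i, j) != (ord_max, ord_max)
          & p = tent_x i * tent_y j]].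

Definition tent_ideal : P -> Prop := ideal_generated tent_equation.

(* A, with the map pi, is the coordinate ring of the tent. *)
Definition tent_coordinate_ring (A : comAlgType K) (pi : {lrmorphism P -> A}) :
    Prop :=
  (forall z : A, exists p : P, pi p = z) /\
  (forall p : P, pi p = 0 <-> tent_ideal p).

Definition is_basis (A : lmodType K) (I : eqType) (z : I -> A) : Prop :=
  (forall (t : seq I) (c : I -> K), uniq t ->
     \sum_(i <- t) c i *: z i = 0 -> forall i, i \in t -> c i = 0) /\
  (forall v : A, exists (t : seq I) (c : I -> K), v = \sum_(i <- t) c i *: z i).

(* A is the ring with basis the lattice points z m, m in the lattice, and
   with the product defined by the fan. *)
Definition fan_ring (r a b s : nat) (A : comAlgType K) (z : lattice -> A) :
    Prop :=
  is_basis z /\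
  (forall m m' : lattice,
     (common_cone r a b s m m' -> z m * z m' = z (m + m')) /\
     (~ common_cone r a b s m m' -> z m * z m' = 0)).

Definition tent_given_by_fan (r a b s : nat) : Prop :=
  exists (x : k.+1.-tuple lattice) (y : l.+1.-tuple lattice)
         (A : comAlgType K) (pi : {lrmorphism P -> A}) (z : lattice -> A),
    [/\ fan_monomials r a b s x y,
        tent_coordinate_ring pi,
        fan_ring r a b s z,
        (forall i, pi (tent_x i) = z (tnth x i))
      & (forall j, pi (tent_y j) = z (tnth y j))].

End Tent.

(* Main.v *)
(* The monomials x_1, ..., x_k = xi, eta = y_l, ..., y_0 turn around the origin,
   consecutive ones form bases of the lattice, and each tag c_i comes from
   v_(i-1) + v_(i+1) = c_i v_i.  Hence [c_i, ..., c_j] has numerator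
   wedge v_(i-1) v_(j+1) up to sign, and the two continued fractions of the
   statement vanish exactly when x_1, resp. y_1, is parallel to y_0, resp. x_0.

   In a fan, ab < rs forces b < r or a < s, and then x_1 = - y_0 or y_1 = - x_0.
   Conversely the expansions of r / (r - alpha) and s / (s - beta) determine
   x_i and y_j by recurrence from xi and eta; x_1 and y_0 are primitive, so they
   are equal or opposite.  If a_k, b_l >= 0 then m |-> m.2 - m.1 is positive on
   the x_i and negative on the y_j, which excludes equality.

   The ring of the fan is realized inside K[u, v]^4, one factor for each cone,
   by sending a lattice point to its monomial in the cones that contain it.  The
   kernel of K[x_i, y_j] -> K[u, v]^4 is the tent ideal: modulo that ideal a
   monomial whose support is not in a single cone vanishes, and two other
   monomials agree when they have the same lattice point. *)

From HB Require Import structures.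
From Stdlib Require Import ClassicalEpsilon.
From mathcomp Require Import ring lra zify.
Require Import Defs.
Import Order.TTheory GRing.Theory Num.Theory.
Local Open Scope ring_scope.

Set Implicit Arguments.
Unset Strict Implicit.
Unset Printing Implicit Defensive.

(** * The image of an algebra morphism *)

(** The product of the fan ring is defined by cases on cones, so its axioms would be tedious to
    check directly. Inside K[u, v]^4 they come for free, and what remains, the product rule and the
    independence of the lattice points, is read off one component at a time. The components fit
    together because two cones of the fan meet in a common face.

    A tent given by a fan is tied to the lattice only through its labels. The bridge is that basis
    elements with different lattice points differ: a binomial equation of a quotient singularity
    holds among the basis elements, hence becomes a linear relation between lattice points. In this
    way the recurrence of the exponents passes to the x_i and y_j with the same tags. *)

Definition asbool (P : Prop) : bool :=
  if excluded_middle_informative P then true else false.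

Lemma asboolP (P : Prop) : reflect P (asbool P).
Proof. by rewrite /asbool; case: excluded_middle_informative => ?; constructor. Qed.

Section ImageAlgebra.
Variables (K : fieldType) (R B : comAlgType K) (F : {lrmorphism R -> B}).

(** Substructures are carved out by Boolean predicates, whereas lying in the image is an existential
    statement; classical logic decides it. *)
Definition in_image : {pred B} := fun b => asbool (exists p, F p = b).

Lemma in_imageP b : reflect (exists p, F p = b) (b \in in_image).
Proof. exact: asboolP. Qed.

Lemma mem_image p : F p \in in_image.
Proof. by apply/in_imageP; exists p. Qed.

Lemma in_image_subalg : subalg_closed in_image.
Proof.
split=> [|a u v|u v].
- by apply/in_imageP; exists 1; rewrite rmorph1.
- move=> /in_imageP[p <-] /in_imageP[q <-].
  by apply/in_imageP; exists (a *: p + q); rewrite linearP.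
- move=> /in_imageP[p <-] /in_imageP[q <-].
  by apply/in_imageP; exists (p * q); rewrite rmorphM.
Qed.

HB.instance Definition _ := GRing.isSubalgClosed.Build K B in_image in_image_subalg.

Record image_alg := ImageAlg { image_val : B; image_valP : image_val \in in_image }.

HB.instance Definition _ := [isSub for image_val].
HB.instance Definition _ := [Choice of image_alg by <:].
HB.instance Definition _ := [SubChoice_isSubAlgebra of image_alg by <:].
HB.instance Definition _ := GRing.SubNzRing_isSubComNzRing.Build B in_image image_alg.

Definition to_image p : image_alg := ImageAlg (mem_image p).

Lemma to_image_is_linear : linear to_image.
Proof. by move=> a p q; apply: val_inj; rewrite /= linearP. Qed.

Lemma to_image_is_monoid_morphism : monoid_morphism to_image.
Proof. by split=> [|p q]; apply: val_inj; rewrite /= ?rmorph1 ?rmorphM. Qed.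

HB.instance Definition _ :=
  GRing.isLinear.Build K R image_alg _ to_image to_image_is_linear.
HB.instance Definition _ :=
  GRing.isMonoidMorphism.Build R image_alg to_image to_image_is_monoid_morphism.

Lemma to_image_surj (z : image_alg) : exists p, to_image p = z.
Proof. by case: z => b /[dup] /in_imageP[p <-] h; exists p; apply: val_inj. Qed.
End ImageAlgebra.

(** * Charts on the four cones of the fan *)

Variant quadrant := Q0 | Q1 | Q2 | Q3.

Lemma muln_absz (d : nat) (x : int) : 0 <= x -> d%:Z *+ `|x|%N = x *+ d.
Proof.
move=> x0; rewrite -[LHS]mulr_natr -[RHS]mulr_natr !natz mulrC.
by rewrite gez0_abs.
Qed.

Lemma pairD (x y z t : int) : (x + y, z + t) = (x, z) + (y, t) :> lattice.
Proof. by []. Qed.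

Section Fan.
Variables (r a b s : nat).
Hypothesis rsab : fan_matrix r a b s.

Let rs1 : r%:Z * s%:Z = a%:Z * b%:Z + 1.
Proof. by move: rsab; rewrite /fan_matrix => <-; ring. Qed.

Let r_gt0 : 0 < r%:Z. Proof. by move: rs1; case: (r) => [|//]; lia. Qed.
Let s_gt0 : 0 < s%:Z. Proof. by move: rs1; case: (s) => [|//]; lia. Qed.

(* Integral coordinates in which the cone t is the first quadrant; on Q1 and Q3
   they are the exponents of u and v on 1/r (alpha, 1) and 1/s (beta, 1). *)
Definition chart (t : quadrant) (m : lattice) : lattice :=
  match t with
  | Q0 => (- (s%:Z * m.1 + b%:Z * m.2), - (a%:Z * m.1 + r%:Z * m.2))
  | Q1 => (- m.1, a%:Z * m.1 + r%:Z * m.2)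
  | Q2 => (m.2, m.1)
  | Q3 => (- m.2, s%:Z * m.1 + b%:Z * m.2)
  end.

Definition in_quad t m := (0 <= (chart t m).1) && (0 <= (chart t m).2).

Definition quad_cone t : lattice -> Prop :=
  match t with
  | Q0 => cone (fan_x0 r a) (fan_y0 b s)
  | Q1 => cone (fan_x0 r a) xi
  | Q2 => cone xi eta
  | Q3 => cone (fan_y0 b s) eta
  end.

Lemma chartD t m n : chart t (m + n) = chart t m + chart t n.
Proof.
by case: m n => [m1 m2] [n1 n2]; case: t => //; apply: injective_projections => /=; ring.
Qed.

Lemma chart0 t : chart t 0 = 0.
Proof. by case: t; rewrite /chart /= ?mulr0 ?addr0 ?oppr0. Qed.

Lemma chartMn t m n : chart t (m *+ n) = chart t m *+ n.
Proof. by elim: n => [|n IH]; rewrite ?mulr0n ?chart0 // !mulrS chartD IH. Qed.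

Lemma chart_inj t : injective (chart t).
Proof.
move=> [m1 m2] [n1 n2]; rewrite /chart /=; case: t => //= -[h1 h2]; last 2 first.
- by rewrite h1 h2.
- have e2 : m1 = n1 by nia.
  by rewrite e2 -[m2]opprK h1 opprK.
- have e1 : m1 = n1 by nia.
  have e2 : m2 = n2 by nia.
  by rewrite e1 e2.
- have e2 : m2 = n2 by nia.
  by rewrite e2 -[m1]opprK h1 opprK.
Qed.

Lemma in_quad_cover m : exists t, in_quad t m.
Proof.
case: m => m1 m2.
have [h1|h1] := lerP 0 m1; have [h2|h2] := lerP 0 m2.
- by exists Q2; rewrite /in_quad /= h1 h2.
- have [h|h] := lerP 0 (s%:Z * m1 + b%:Z * m2).
    by exists Q3; rewrite /in_quad /=; lia.
  by exists Q0; rewrite /in_quad /=; nia.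
- have [h|h] := lerP 0 (a%:Z * m1 + r%:Z * m2).
    by exists Q1; rewrite /in_quad /=; lia.
  by exists Q0; rewrite /in_quad /=; nia.
- by exists Q0; rewrite /in_quad /=; nia.
Qed.

(* Two cones of the fan meet in a common face. *)
Lemma in_quad_face t u m n :
  in_quad t m -> in_quad t n -> in_quad u (m + n) -> in_quad u m.
Proof.
have a0 : 0 <= a%:Z by [].
have b0 : 0 <= b%:Z by [].
case: m n => [m1 m2] [n1 n2]; rewrite /in_quad.
move: a0 b0 r_gt0 s_gt0 rs1.
case: t; case: u => //; rewrite /=;
  move: (r%:Z) (s%:Z) (a%:Z) (b%:Z) => R S A B hA hB hR hS RS;
  move=> /andP[h1 h2] /andP[h3 h4] /andP[h5 h6]; apply/andP; split; try nia.
(* For the opposite cones [Q0] and [Q2]: the forms [S * m1 + B * m2] and [A * m1 + R * m2] are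
   nonpositive on [m] and [n] but nonnegative on their sum, so they vanish, and inverting the matrix
   gives [m = 0]. *)
all: have em1 : m1 = R * (S * m1 + B * m2) - B * (A * m1 + R * m2)
       by (transitivity ((R * S - A * B) * m1); [rewrite RS; ring | ring]).
all: have em2 : m2 = S * (A * m1 + R * m2) - A * (S * m1 + B * m2)
       by (transitivity ((R * S - A * B) * m2); [rewrite RS; ring | ring]).
all: have hP : 0 <= (S * m1 + B * m2) + (S * n1 + B * n2)
       by (rewrite (_ : _ + _ = S * (m1 + n1) + B * (m2 + n2)); [nia | ring]).
all: have hQ : 0 <= (A * m1 + R * m2) + (A * n1 + R * n2)
       by (rewrite (_ : _ + _ = A * (m1 + n1) + R * (m2 + n2)); [nia | ring]).
all: have P0 : S * m1 + B * m2 = 0 by lia.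
all: have {P0}Q0 : A * m1 + R * m2 = 0 /\ S * m1 + B * m2 = 0 by lia.
all: move: Q0 em1 em2 => [-> ->]; lia.
Qed.

Lemma in_quadMn t m n : (0 < n)%N -> in_quad t (m *+ n) -> in_quad t m.
Proof.
move=> n0; rewrite /in_quad chartMn pairMnE /= => /andP[].
by rewrite !pmulrn_lge0 // => -> ->.
Qed.

Lemma in_quadD t m n : in_quad t m -> in_quad t n -> in_quad t (m + n).
Proof.
rewrite /in_quad chartD => /andP[h1 h2] /andP[h3 h4].
by apply/andP; split; apply: addr_ge0.
Qed.

Lemma in_quad0 t : in_quad t 0.
Proof. by rewrite /in_quad chart0 lexx. Qed.

Lemma in_quad_muln t m n : in_quad t m -> in_quad t (m *+ n).
Proof.
by move=> hm; elim: n => [|n IH]; rewrite ?mulr0n ?in_quad0 // mulrS in_quadD.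
Qed.

Definition ray1 t := match t with
  | Q0 | Q1 => fan_x0 r a | Q2 => xi | Q3 => fan_y0 b s end.
Definition ray2 t := match t with
  | Q0 => fan_y0 b s | Q1 => xi | Q2 | Q3 => eta end.

Lemma ray_in t : in_quad t (ray1 t) /\ in_quad t (ray2 t).
Proof. by rewrite /in_quad; case: t; split => /=; move: r_gt0 s_gt0 rs1; nia. Qed.

(** The determinant of the two rays up to sign. Multiplying a lattice point of the cone by it makes
    the coefficients on the rays integral: it is the denominator in [cone], and the chart gives the
    coefficients. *)
Definition ray_mult t : nat := match t with Q0 | Q2 => 1 | Q1 => r | Q3 => s end.

Lemma ray_mult_gt0 t : (0 < ray_mult t)%N.
Proof. by case: t. Qed.

Lemma chart_ray1 t : chart t (ray1 t) = ((ray_mult t)%:Z, 0).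
Proof. by case: t; apply: injective_projections => /=; move: rs1; lia. Qed.

Lemma chart_ray2 t : chart t (ray2 t) = (0, (ray_mult t)%:Z).
Proof. by case: t; apply: injective_projections => /=; move: rs1; lia. Qed.

Lemma quad_coneE t m : quad_cone t m = cone (ray1 t) (ray2 t) m.
Proof. by case: t. Qed.

Lemma quad_coneP t m : quad_cone t m <-> in_quad t m.
Proof.
rewrite quad_coneE; split=> [[n [i [j [n0 e]]]]|/andP[h1 h2]].
  apply: (in_quadMn n0); rewrite e; have [h1 h2] := ray_in t.
  by apply: in_quadD; apply: in_quad_muln.
exists (ray_mult t), `|(chart t m).1|%N, `|(chart t m).2|%N.
split; first exact: ray_mult_gt0.
apply: (@chart_inj t); rewrite chartD !chartMn chart_ray1 chart_ray2.
by rewrite !pairMnE /= !mul0rn !muln_absz // -pairD addr0 add0r.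
Qed.

Lemma common_coneP m n :
  common_cone r a b s m n <-> exists t, in_quad t m && in_quad t n.
Proof.
split.
  case=> -[h1 h2]; [exists Q0|exists Q1|exists Q2|exists Q3];
  by apply/andP; split; apply/quad_coneP.
case=> -[] /andP[/quad_coneP h1 /quad_coneP h2].
- by constructor 1. - by constructor 2. - by constructor 3. - by constructor 4.
Qed.
End Fan.

(** * Monomials and grouping of sums *)

Section Monomial.
Variable K : fieldType.

Definition uv_exponent (e : nat * nat) : 'X_{1..2} :=
  (U_(ord0) *+ e.1 + U_(ord_max) *+ e.2)%MM.

Lemma monomialE (e : nat * nat) :
  monomial K e = 'X_[uv_exponent e].
Proof. by rewrite mpolyXD -!mpolyXn. Qed.

Lemma mcoeff_monomial (e e' : nat * nat) :
  (monomial K e)@_(uv_exponent e') = (e == e')%:R.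
Proof.
rewrite monomialE mcoeffX; congr (nat_of_bool _)%:R.
apply/eqP/eqP => [|-> //].
case: e e' => [i j] [i' j'] /= /mnmP h.
move: (h ord0) (h ord_max); rewrite !mnmDE !mulmnE !mnm1E /=. rewrite !mul1n !mul0n !addn0 !add0n.
by move=> -> ->.
Qed.

Lemma monomialD e e' : monomial K (e + e') = monomial K e * monomial K e'.
Proof. by rewrite /monomial /= !exprD mulrACA. Qed.

Lemma monomial0 : monomial K 0 = 1.
Proof. by rewrite /monomial !expr0 mulr1. Qed.

Lemma monomialMn e n : monomial K (e *+ n) = monomial K e ^+ n.
Proof. by elim: n => [|n IH]; rewrite ?mulr0n ?monomial0 ?expr0 // mulrS exprS monomialD IH. Qed.

Lemma monomial_sum (I : Type) (t : seq I) (F : I -> nat * nat) :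
  monomial K (\sum_(i <- t) F i) = \prod_(i <- t) monomial K (F i).
Proof. exact: (big_morph _ monomialD monomial0). Qed.

Lemma monomial_comp n (e : 'I_n -> nat * nat) (c : 'X_{1..n}) :
  'X_[c] \mPo [tuple monomial K (e i) | i < n] = monomial K (\sum_i e i *+ c i).
Proof.
by rewrite comp_mpolyX monomial_sum; apply: eq_bigr => i _; rewrite tnth_mktuple monomialMn.
Qed.
End Monomial.

Section Grouping.
Variables (K : pzRingType) (I T : eqType) (V : lmodType K).

Lemma sum_by_key (t : seq I) (p : I -> K) (key : I -> T) (F : T -> V) :
  \sum_(i <- t) p i *: F (key i) =
  \sum_(m <- undup (map key t)) (\sum_(i <- t | key i == m) p i) *: F m.
Proof.
under [RHS]eq_bigr do rewrite scaler_suml.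
rewrite (exchange_big_dep xpredT) //=; apply: eq_big_seq => i it.
rewrite -big_filter (_ : filter _ _ = [:: key i]) ?big_seq1 //.
rewrite (eq_filter (a2 := pred1 (key i))) => [|m]; last by rewrite /= eq_sym.
by rewrite filter_pred1_uniq ?undup_uniq // mem_undup map_f.
Qed.

Lemma sum_by_key_eq0 (t : seq I) (p : I -> K) (key : I -> T) (F : T -> V) :
  (forall m, \sum_(i <- t | key i == m) p i = 0) ->
  \sum_(i <- t) p i *: F (key i) = 0.
Proof.
by move=> h; rewrite sum_by_key big1 // => m _; rewrite h scale0r.
Qed.
End Grouping.

(** * The ring of a fan *)

Definition absz2 (m : lattice) : nat * nat := (`|m.1|%N, `|m.2|%N).

Lemma absz2D (m n : lattice) : 0 <= m.1 -> 0 <= m.2 -> 0 <= n.1 -> 0 <= n.2 ->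
  absz2 (m + n) = absz2 m + absz2 n.
Proof.
case: m n => [m1 m2] [n1 n2] /= h1 h2 h3 h4; congr pair => /=; rewrite /GRing.add /=; lia.
Qed.

Section Quadruple.
Variables (K : fieldType) (R A : comAlgType K).

Definition quad_ring : comAlgType K := (A * A * A * A)%type.

Definition quadruple (f : quadrant -> A) : quad_ring := (f Q0, f Q1, f Q2, f Q3).

Definition component (w : quad_ring) (t : quadrant) : A :=
  match t with Q0 => w.1.1.1 | Q1 => w.1.1.2 | Q2 => w.1.2 | Q3 => w.2 end.

Lemma component_inj w w' : (forall t, component w t = component w' t) -> w = w'.
Proof.
case: w => [[[w1 w2] w3] w4]; case: w' => [[[w1' w2'] w3'] w4'] h.
by move: (h Q0) (h Q1) (h Q2) (h Q3) => /= -> -> -> ->.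
Qed.

Lemma component_quadruple f t : component (quadruple f) t = f t.
Proof. by case: t. Qed.

Lemma componentM w w' t : component (w * w') t = component w t * component w' t.
Proof. by case: t. Qed.

Lemma componentD w w' t : component (w + w') t = component w t + component w' t.
Proof. by case: t. Qed.

Lemma componentZ (c : K) w t : component (c *: w) t = c *: component w t.
Proof. by case: t. Qed.

Lemma component0 t : component 0 t = 0.
Proof. by case: t. Qed.

Lemma component1 t : component 1 t = 1.
Proof. by case: t. Qed.

Lemma component_sum (I : Type) (l : seq I) (c : I -> K) (w : I -> quad_ring) t :
  component (\sum_(i <- l) c i *: w i) t = \sum_(i <- l) c i *: component (w i) t.
Proof.
by elim: l => [|i l IH]; rewrite ?big_nil ?component0 // !big_cons componentD componentZ IH.
Qed.

Variable F : quadrant -> {lrmorphism R -> A}.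

Definition quad_fun (p : R) : quad_ring := quadruple (fun t => F t p).

Lemma quad_fun_is_linear : linear quad_fun.
Proof.
move=> c p q; apply: component_inj => t.
by rewrite componentD componentZ !component_quadruple linearP.
Qed.

Lemma quad_fun_is_monoid_morphism : monoid_morphism quad_fun.
Proof.
split=> [|p q]; apply: component_inj => t.
  by rewrite component1 component_quadruple rmorph1.
by rewrite componentM !component_quadruple rmorphM.
Qed.

HB.instance Definition _ := GRing.isLinear.Build K R quad_ring _ quad_fun quad_fun_is_linear.
HB.instance Definition _ :=
  GRing.isMonoidMorphism.Build R quad_ring quad_fun quad_fun_is_monoid_morphism.

Definition quad_eval : {lrmorphism R -> quad_ring} := quad_fun.

Lemma component_quad p t : component (quad_eval p) t = F t p.
Proof. exact: component_quadruple. Qed.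
End Quadruple.

Section FanAlgebra.
Variables (K : fieldType) (r a b s : nat) (N : nat) (g : 'I_N -> lattice).
Hypothesis rsab : fan_matrix r a b s.

Local Notation in_quad := (in_quad r a b s).
Local Notation chart := (chart r a b s).
Local Notation P := {mpoly K[N]}.
Local Notation K2 := {mpoly K[2]}.

Definition chart_monomial t m : K2 :=
  if in_quad t m then monomial K (absz2 (chart t m)) else 0.

Lemma chart_monomialM t m n : in_quad t m -> in_quad t n ->
  chart_monomial t m * chart_monomial t n = chart_monomial t (m + n).
Proof.
move=> hm hn; rewrite /chart_monomial hm hn in_quadD // -monomialD chartD //.
by move: hm hn => /andP[? ?] /andP[? ?]; rewrite absz2D.
Qed.

Lemma chart_monomial0 t : chart_monomial t 0 = 1.
Proof. by rewrite /chart_monomial in_quad0 chart0 -(monomial0 K). Qed.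

Lemma chart_monomialMn t m n : in_quad t m ->
  chart_monomial t m ^+ n = chart_monomial t (m *+ n).
Proof.
move=> hm; elim: n => [|n IH]; first by rewrite mulr0n expr0 chart_monomial0.
by rewrite exprS mulrS IH chart_monomialM // in_quad_muln.
Qed.

(** The cone [u] that contains both points need not be [t]. By the face property, [m + n] lies in
    [t] only if both points do, so the two sides vanish together. *)
Lemma chart_monomial_common t u m n : in_quad u m -> in_quad u n ->
  chart_monomial t m * chart_monomial t n = chart_monomial t (m + n).
Proof.
move=> hm hn; case tm : (in_quad t m); case tn : (in_quad t n).
- exact: chart_monomialM.
- rewrite /chart_monomial tm tn mulr0; case: ifP => // h.
  by move: h; rewrite addrC => h; rewrite (in_quad_face rsab hn hm h) in tn.
- rewrite /chart_monomial tm tn mul0r; case: ifP => // h.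
  by rewrite (in_quad_face rsab hm hn h) in tm.
- rewrite /chart_monomial tm tn mul0r; case: ifP => // h.
  by rewrite (in_quad_face rsab hm hn h) in tm.
Qed.

Definition degree (c : 'X_{1..N}) : lattice := \sum_i g i *+ c i.

Definition supp_in t (c : 'X_{1..N}) := [forall i, (0 < c i)%N ==> in_quad t (g i)].

Definition standard c := [|| supp_in Q0 c, supp_in Q1 c, supp_in Q2 c | supp_in Q3 c].

Lemma standardP c : reflect (exists t, supp_in t c) (standard c).
Proof.
apply: (iffP idP) => [/or4P[]|[[]]]; rewrite /standard; try by eexists; eassumption.
all: by move->; rewrite ?orbT.
Qed.

Lemma supp_in_degree t c : supp_in t c -> in_quad t (degree c).
Proof.
move=> /forallP h; apply: (big_ind (fun m => in_quad t m)).
- exact: in_quad0.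
- by move=> *; apply: in_quadD.
- move=> i _; have := h i; case: (c i) => [|n] /=; first by rewrite mulr0n in_quad0.
  exact: in_quad_muln.
Qed.

(** Split the lattice point as the contribution of one variable plus the rest. Both lie in [t], so
    the face property puts the first, hence the variable, into [u]. *)
Lemma supp_in_face t u c : supp_in t c -> in_quad u (degree c) -> supp_in u c.
Proof.
move=> tc uc; apply/forallP => i; apply/implyP => ci.
have tm : in_quad t (\sum_(j | j != i) g j *+ c j).
  apply: (big_ind (fun m => in_quad t m)).
  - exact: in_quad0.
  - by move=> *; apply: in_quadD.
  - move=> j _; have /implyP := forallP tc j.
    case: (c j) => [|n] /=; first by rewrite mulr0n in_quad0.
    by move=> /(_ isT); apply: in_quad_muln.
have tg : in_quad t (g i) by have /implyP := forallP tc i; apply.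
apply: (in_quadMn (n := c i)) => //.
apply: (in_quad_face rsab (in_quad_muln _ tg) tm).
by move: uc; rewrite /degree (bigD1 i).
Qed.

Definition chart_tuple t := [tuple chart_monomial t (g i) | i < N].

Lemma chart_tupleX t c : 'X_[c] \mPo chart_tuple t =
  if supp_in t c then chart_monomial t (degree c) else 0.
Proof.
rewrite comp_mpolyX; case: ifP => [tc|].
  (* Products of chart monomials are computed only inside the cone, so membership of the partial
     sums travels along with the product. *)
  pose R (p : K2) m := in_quad t m /\ p = chart_monomial t m.
  have : R (\prod_(i < N) tnth (chart_tuple t) i ^+ c i) (degree c).
    apply: (big_ind2 R).
    - by split; rewrite ?in_quad0 ?chart_monomial0.
    - by move=> p m q n [? ->] [? ->]; split; rewrite ?in_quadD ?chart_monomialM.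
    - move=> i _; have /implyP := forallP tc i; rewrite tnth_mktuple.
      case: (c i) => [_|n h]; first by split; rewrite ?mulr0n ?in_quad0 ?expr0 ?chart_monomial0.
      by split; rewrite ?in_quad_muln ?chart_monomialMn ?h.
  by case.
move=> /negbT; rewrite negb_forall => /existsP[i]; rewrite negb_imply => /andP[ci ti].
by rewrite (bigD1 i) //= tnth_mktuple /chart_monomial (negbTE ti) expr0n eqn0Ngt ci mul0r.
Qed.

Definition chart_eval t : {lrmorphism P -> K2} := comp_mpoly (chart_tuple t).
Local Notation B := (quad_ring K2).
Definition charts_eval : {lrmorphism P -> B} := quad_eval chart_eval.

Lemma component_eval p t : component (charts_eval p) t = p \mPo chart_tuple t.
Proof. exact: component_quad. Qed.

Definition point (m : lattice) : B := quadruple (fun t => chart_monomial t m : K2).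

Lemma component_point m t : component (point m) t = chart_monomial t m.
Proof. exact: component_quadruple. Qed.

Lemma charts_evalX c : charts_eval 'X_[c] = if standard c then point (degree c) else 0.
Proof.
apply: component_inj => t; rewrite component_eval chart_tupleX.
case: ifP (standardP c) => [tc|tc] [[u uc]|h] /=.
- by rewrite component_point.
- by case: h; exists t.
- rewrite component_point /chart_monomial; case: ifP => // h.
  by rewrite (supp_in_face uc h) in tc.
- by rewrite component0.
Qed.

Lemma pointM m n : (common_cone r a b s m n -> point m * point n = point (m + n)) /\
  (~ common_cone r a b s m n -> point m * point n = 0).
Proof.
split=> h; apply: component_inj => t; rewrite componentM !component_point.
  by have /(common_coneP rsab)[u /andP[um un]] := h; apply: chart_monomial_common um un.
rewrite component0 /chart_monomial; case: ifP => tm; last by rewrite mul0r.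
case: ifP => tn; last by rewrite mulr0.
by case: h; apply/(common_coneP rsab); exists t; rewrite tm tn.
Qed.

(** A cone [t] containing [m] isolates [k m]: charts are injective, so in the component at [t] no
    other lattice point contributes to the monomial of [m]. *)
Lemma point_free (l : seq lattice) (k : lattice -> K) : uniq l ->
  \sum_(m <- l) k m *: point m = 0 -> forall m, m \in l -> k m = 0.
Proof.
move=> ul e m ml; have [t tm] := in_quad_cover rsab m.
have := congr1 (fun w : B => component w t) e; rewrite /= component_sum component0 => {}e.
pose c := absz2 (chart t m).
have := congr1 (mcoeff (uv_exponent c)) e.
rewrite linear0 linear_sum /= (bigD1_seq m) //= mcoeffZ component_point {1}/chart_monomial tm.
rewrite mcoeff_monomial eqxx mulr1 big1 ?addr0 // => n nm.
rewrite mcoeffZ component_point /chart_monomial.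
case: ifP => tn; last by rewrite mcoeff0 mulr0.
rewrite mcoeff_monomial; case: eqP => [h|]; last by rewrite mulr0.
case/eqP: nm; apply: (@chart_inj r a b s rsab t); move: h tm tn.
rewrite /c /absz2 /in_quad; case: (chart t n) (chart t m) => [n1 n2] [m1 m2] /= [? ?].
by move=> /andP[? ?] /andP[? ?]; congr pair; lia.
Qed.

Section Evaluation.
Variables (B' : comAlgType K) (F : {lrmorphism P -> B'}) (pt : lattice -> B').
Hypothesis evalX : forall c, F 'X_[c] = if standard c then pt (degree c) else 0.
Hypothesis ptM : forall m n, (common_cone r a b s m n -> pt m * pt n = pt (m + n)) /\
  (~ common_cone r a b s m n -> pt m * pt n = 0).
Hypothesis pt_free : forall (l : seq lattice) (k : lattice -> K), uniq l ->
  \sum_(m <- l) k m *: pt m = 0 -> forall m, m \in l -> k m = 0.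

Local Notation FanAlg := (image_alg F).
Local Notation fan_proj := (to_image F).

Hypothesis degree_surj : forall m, exists c, degree c = m /\ standard c.

(** An element of the image has to be given by a polynomial above it. Any standard monomial with
    lattice point [m] serves, since by [evalX] all of them have the same value. *)
Definition std_repr m : 'X_{1..N} :=
  proj1_sig (constructive_indefinite_description _ (degree_surj m)).

Lemma std_reprP m : degree (std_repr m) = m /\ standard (std_repr m).
Proof. exact: proj2_sig (constructive_indefinite_description _ (degree_surj m)). Qed.

Definition fan_point m : FanAlg := fan_proj 'X_[std_repr m].

Lemma val_fan_point m : image_val (fan_point m) = pt m.
Proof. by rewrite [LHS]evalX; have [-> ->] := std_reprP m. Qed.

Lemma fan_projX c : fan_proj 'X_[c] = if standard c then fan_point (degree c) else 0.
Proof.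
apply: val_inj; rewrite [LHS]evalX; case: ifP => _ //.
by rewrite [RHS]val_fan_point.
Qed.

Lemma fan_projU i : fan_proj 'X_i = fan_point (g i).
Proof.
have [t tg] := in_quad_cover rsab (g i).
have d : degree U_(i)%MM = g i.
  rewrite /degree (bigD1 i) //= mnm1E eqxx mulr1n big1 ?addr0 // => j ji.
  by rewrite mnm1E eq_sym (negbTE ji) mulr0n.
rewrite fan_projX d (introT (standardP _)) //; exists t; apply/forallP => j.
by apply/implyP; rewrite mnm1E; case: eqP => [<-|].
Qed.

Lemma fan_point_free (l : seq lattice) (k : lattice -> K) : uniq l ->
  \sum_(m <- l) k m *: fan_point m = 0 -> forall m, m \in l -> k m = 0.
Proof.
move=> ul e; apply: pt_free => //.
transitivity (image_val (\sum_(m <- l) k m *: fan_point m)); last by rewrite e.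
rewrite [RHS](raddf_sum val); apply: eq_bigr => m _.
by rewrite -val_fan_point.
Qed.

Lemma fan_projE p : fan_proj p =
  \sum_(c <- [seq c <- msupp p | standard c]) p@_c *: fan_point (degree c).
Proof.
rewrite {1}[p]mpolyE raddf_sum big_filter [RHS]big_mkcond /=.
apply: eq_bigr => c _; transitivity (p@_c *: fan_proj 'X_[c]); first exact: linearZ_LR.
by rewrite fan_projX; case: ifP => // _; rewrite scaler0.
Qed.

(** Independence of the points turns the kernel into a condition on coefficients alone, which can
    then be compared with the tent ideal. *)
Lemma fan_proj_eq0 p : fan_proj p = 0 <->
  forall m, \sum_(c <- msupp p | standard c && (degree c == m)) p@_c = 0.
Proof.
rewrite fan_projE; split=> [e m|h]; last first.
  by apply: sum_by_key_eq0 => m; rewrite big_filter_cond.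
move: e; rewrite sum_by_key => /(fan_point_free (undup_uniq _)) /(_ m).
rewrite big_filter_cond mem_undup; case: (boolP (m \in _)) => [_|h _]; first exact.
rewrite big1_seq // => c /andP[/andP[sc /eqP dc] cp]; case/negP: h.
by apply/mapP; exists c; rewrite ?mem_filter ?sc ?dc.
Qed.

Lemma fan_algebraP : fan_ring r a b s fan_point.
Proof.
split; first split=> [|z]; first exact: fan_point_free.
- have [p <-] := to_image_surj z.
  pose l := [seq c <- msupp p | standard c].
  exists (undup (map degree l)), (fun m => \sum_(c <- l | degree c == m) p@_c).
  by rewrite -sum_by_key -fan_projE.
- move=> m n; have [h1 h2] := ptM m n.
  have e : image_val (fan_point m * fan_point n) = pt m * pt n by rewrite -!val_fan_point.
  split=> h; apply: val_inj; rewrite [LHS]e; last exact: h2.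
  by rewrite h1 // -val_fan_point.
Qed.

Lemma presentation_of_eval :
  exists (A : comAlgType K) (pi : {lrmorphism P -> A}) (z : lattice -> A),
  [/\ forall w, exists p, pi p = w,
      forall p, pi p = 0 <->
        forall m, \sum_(c <- msupp p | standard c && (degree c == m)) p@_c = 0,
      fan_ring r a b s z,
      forall c, pi 'X_[c] = if standard c then z (degree c) else 0
    & forall i, pi 'X_i = z (g i)].
Proof.
exists (image_alg F), fan_proj, fan_point; split.
- exact: to_image_surj.
- exact: fan_proj_eq0.
- exact: fan_algebraP.
- exact: fan_projX.
- exact: fan_projU.
Qed.
End Evaluation.

Lemma fan_presentation : (forall m, exists c, degree c = m /\ standard c) ->
  exists (A : comAlgType K) (pi : {lrmorphism P -> A}) (z : lattice -> A),
  [/\ forall w, exists p, pi p = w,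
      forall p, pi p = 0 <->
        forall m, \sum_(c <- msupp p | standard c && (degree c == m)) p@_c = 0,
      fan_ring r a b s z,
      forall c, pi 'X_[c] = if standard c then z (degree c) else 0
    & forall i, pi 'X_i = z (g i)].
Proof. exact: presentation_of_eval charts_evalX pointM point_free. Qed.
End FanAlgebra.

(** * The tent ideal *)

Section Ideal.
Variables (R : comNzRingType) (S : R -> Prop).
Local Notation I := (ideal_generated S).

Lemma ideal_gen x : S x -> I x.
Proof.
by move=> Sx; exists 1%N, (fun=> 1), (fun=> x); split=> //; rewrite big_ord1 mul1r.
Qed.

Lemma ideal0 : I 0.
Proof. by exists 0%N, (fun=> 0), (fun=> 0); split=> [[]//|]; rewrite big_ord0. Qed.

Lemma idealD x y : I x -> I y -> I (x + y).
Proof.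
move=> [n [c [g [Sg ->]]]] [m [d [h [Sh ->]]]].
exists (n + m)%N, (fun i => match split i with inl i => c i | inr i => d i end),
  (fun i => match split i with inl i => g i | inr i => h i end); split.
  by move=> i; case: split.
rewrite big_split_ord /=; congr (_ + _); apply: eq_bigr => i _.
  by rewrite (unsplitK (inl i)).
by rewrite (unsplitK (inr i)).
Qed.

Lemma idealMl z x : I x -> I (z * x).
Proof.
move=> [n [c [g [Sg ->]]]]; exists n, (fun i => z * c i), g; split=> //.
by rewrite mulr_sumr; apply: eq_bigr => i _; rewrite mulrA.
Qed.

Lemma ideal_sum (J : Type) (l : seq J) (Q : pred J) (F : J -> R) :
  (forall j, Q j -> I (F j)) -> I (\sum_(j <- l | Q j) F j).
Proof. by move=> h; apply: big_ind => //; [exact: ideal0|exact: idealD]. Qed.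
End Ideal.

Lemma idealZ (K : fieldType) n (S : {mpoly K[n]} -> Prop) c x :
  ideal_generated S x -> ideal_generated S (c *: x).
Proof. by rewrite -mul_mpolyC; apply: idealMl. Qed.

Section QuotientIdeal.
Variables (K : fieldType) (k : nat) (e : k.+1.-tuple (nat * nat)).

Lemma quotient_ideal_coeff (q : {mpoly K[k.+1]}) n : quotient_ideal e q ->
  \sum_(c <- msupp q | \sum_i tnth e i *+ c i == n) q@_c = 0.
Proof.
move=> h; have := congr1 (mcoeff (uv_exponent n)) h.
rewrite mcoeff0 comp_mpolyEX raddf_sum /= => h0; rewrite -[RHS]h0.
rewrite [LHS]big_mkcond /=; apply: eq_bigr => c _.
rewrite mcoeffZ monomial_comp mcoeff_monomial.
by case: eqP => _; rewrite ?mulr1 ?mulr0.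
Qed.

Lemma quotient_ideal_binomial (c d : 'X_{1..k.+1}) :
  \sum_i tnth e i *+ c i = \sum_i tnth e i *+ d i ->
  quotient_ideal (K := K) e ('X_[c] - 'X_[d]).
Proof. by move=> h; rewrite /quotient_ideal comp_mpolyB !monomial_comp h subrr. Qed.
End QuotientIdeal.

(** * The tent ideal as the kernel of the map to the fan ring *)

Section Tent.
Variables (K : fieldType) (r a b s : nat).
Hypothesis rsab : fan_matrix r a b s.
Variables (k l : nat) (x : k.+1.-tuple lattice) (y : l.+1.-tuple lattice).
Variables (e : k.+1.-tuple (nat * nat)) (f : l.+1.-tuple (nat * nat)).
Hypotheses (k0 : (0 < k)%N) (l0 : (0 < l)%N).
Local Notation chart := (chart r a b s).
Local Notation in_quad := (in_quad r a b s).
Definition to_lattice (n : nat * nat) : lattice := (n.1%:Z, n.2%:Z).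

Hypothesis chart_x : forall i, chart Q1 (tnth x i) = to_lattice (tnth e i).
Hypothesis chart_y : forall j, chart Q3 (tnth y j) = to_lattice (tnth f j).
Hypothesis e_first : forall i, (tnth e i).2 = 0%N <-> i = ord0.
Hypothesis e_last : forall i, (tnth e i).1 = 0%N <-> i = ord_max.
Hypothesis f_first : forall j, (tnth f j).2 = 0%N <-> j = ord0.
Hypothesis f_last : forall j, (tnth f j).1 = 0%N <-> j = ord_max.
Hypothesis x_gen : forall m, in_quad Q1 m -> exists c : 'X_{1..k.+1}, m = \sum_i tnth x i *+ c i.
Hypothesis y_gen : forall m, in_quad Q3 m -> exists c : 'X_{1..l.+1}, m = \sum_j tnth y j *+ c j.
Hypotheses (x_first : tnth x ord0 = fan_x0 r a) (x_last : tnth x ord_max = xi).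
Hypotheses (y_first : tnth y ord0 = fan_y0 b s) (y_last : tnth y ord_max = eta).

Definition gens (i : 'I_(k.+1 + l.+1)) : lattice :=
  match split i with inl i => tnth x i | inr j => tnth y j end.

Lemma gens_x i : gens (lshift _ i) = tnth x i.
Proof. by rewrite /gens (unsplitK (inl i)). Qed.

Lemma gens_y j : gens (rshift _ j) = tnth y j.
Proof. by rewrite /gens (unsplitK (inr j)). Qed.

Lemma in_quad_x i t : in_quad t (tnth x i) =
  match t with Q0 => i == ord0 | Q1 => true | Q2 => i == ord_max | Q3 => false end.
Proof.
have := chart_x i; rewrite /in_quad; have := e_first i; have := e_last i.
have := rsab; rewrite /fan_matrix => h.
have o : (ord0 : 'I_k.+1) <> ord_max by move=> /(congr1 val) /=; lia.
case: (tnth x i) (tnth e i) => [m1 m2] [e1 e2] /= el ef [h1 h2].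
case: t => /=.
- apply/andP/eqP => [[? ?]|/ef e20]; [apply/ef|]; first by lia.
  (* Here the second [Q1] coordinate vanishes, and solving the chart for [m1] fixes the sign of the
     remaining [Q0] coordinate. *)
  have : r%:Z * (s%:Z * m1 + b%:Z * m2) = m1.
    transitivity (m1 * (r%:Z * s%:Z - a%:Z * b%:Z) + b%:Z * (a%:Z * m1 + r%:Z * m2)); first by ring.
    by rewrite h h2 e20; ring.
  by nia.
- by rewrite h1 h2.
- apply/andP/eqP => [[? ?]|/el ?]; [apply/el|]; try nia.
- apply/negP => /andP[? ?].
  (* In [Q1] and [Q3] at once the point would be 0, so [i] would be both the first and the last
     index, against [0 < k]. *)
  have m10 : m1 = 0 by nia.
  have m20 : m2 = 0 by nia.
  by case: o; transitivity i; [apply/esym/ef|apply/el]; nia.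
Qed.

Lemma in_quad_y j t : in_quad t (tnth y j) =
  match t with Q0 => j == ord0 | Q1 => false | Q2 => j == ord_max | Q3 => true end.
Proof.
have := chart_y j; rewrite /in_quad; have := f_first j; have := f_last j.
have := rsab; rewrite /fan_matrix => h.
have o : (ord0 : 'I_l.+1) <> ord_max by move=> /(congr1 val) /=; lia.
case: (tnth y j) (tnth f j) => [m1 m2] [e1 e2] /= el ef [h1 h2].
case: t => /=.
- apply/andP/eqP => [[? ?]|/ef e20]; [apply/ef|]; first by lia.
  have : s%:Z * (a%:Z * m1 + r%:Z * m2) = m2.
    transitivity (m2 * (r%:Z * s%:Z - a%:Z * b%:Z) + a%:Z * (s%:Z * m1 + b%:Z * m2)); first by ring.
    by rewrite h h2 e20; ring.
  by nia.
- apply/negP => /andP[? ?].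
  have m10 : m1 = 0 by nia.
  have m20 : m2 = 0 by nia.
  by case: o; transitivity j; [apply/esym/ef|apply/el]; nia.
- apply/andP/eqP => [[? ?]|/el ?]; [apply/el|]; try nia.
- by rewrite h1 h2.
Qed.

Definition widen_x (c : 'X_{1..k.+1}) : 'X_{1..k.+1 + l.+1} :=
  [multinom match split i with inl i => c i | inr _ => 0%N end | i < k.+1 + l.+1].
Definition widen_y (c : 'X_{1..l.+1}) : 'X_{1..k.+1 + l.+1} :=
  [multinom match split i with inl _ => 0%N | inr j => c j end | i < k.+1 + l.+1].
Definition restrict_x (c : 'X_{1..k.+1 + l.+1}) : 'X_{1..k.+1} :=
  [multinom c (lshift _ i) | i < k.+1].
Definition restrict_y (c : 'X_{1..k.+1 + l.+1}) : 'X_{1..l.+1} :=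
  [multinom c (rshift _ i) | i < l.+1].

Lemma widen_x_l c i : widen_x c (lshift _ i) = c i.
Proof. by rewrite mnmE (unsplitK (inl i)). Qed.

Lemma widen_x_r c j : widen_x c (rshift _ j) = 0%N.
Proof. by rewrite mnmE (unsplitK (inr j)). Qed.

Lemma widen_y_l c i : widen_y c (lshift _ i) = 0%N.
Proof. by rewrite mnmE (unsplitK (inl i)). Qed.

Lemma widen_y_r c j : widen_y c (rshift _ j) = c j.
Proof. by rewrite mnmE (unsplitK (inr j)). Qed.

Lemma mnm_split (c d : 'X_{1..k.+1 + l.+1}) :
  (forall i, c (lshift _ i) = d (lshift _ i)) ->
  (forall j, c (rshift _ j) = d (rshift _ j)) -> c = d.
Proof.
move=> h1 h2; apply/mnmP => i; rewrite -[i]splitK.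
by case: (split i) => i'; [apply: h1|apply: h2].
Qed.

Lemma comp_tent_x c : 'X_[c] \mPo [tuple tent_x K l i | i < k.+1] = 'X_[widen_x c].
Proof.
rewrite comp_mpolyX mpolyXE_id big_split_ord /=.
rewrite [X in _ = _ * X]big1 ?mulr1 => [|j _]; last by rewrite widen_x_r expr0.
by apply: eq_bigr => i _; rewrite tnth_mktuple widen_x_l.
Qed.

Lemma comp_tent_y c : 'X_[c] \mPo [tuple tent_y K k j | j < l.+1] = 'X_[widen_y c].
Proof.
rewrite comp_mpolyX mpolyXE_id big_split_ord /=.
rewrite [X in _ = X * _]big1 ?mul1r => [|j _]; last by rewrite widen_y_l expr0.
by apply: eq_bigr => i _; rewrite tnth_mktuple widen_y_r.
Qed.

Local Notation degree := (degree gens).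
Local Notation supp_in := (supp_in r a b s gens).
Local Notation standard := (standard r a b s gens).

Lemma degreeE (c : 'X_{1..k.+1 + l.+1}) : degree c =
  \sum_i tnth x i *+ c (lshift _ i) + \sum_j tnth y j *+ c (rshift _ j).
Proof.
rewrite /degree big_split_ord /=.
by congr (_ + _); apply: eq_bigr => i _; rewrite ?gens_x ?gens_y.
Qed.

Lemma degree_x c : degree (widen_x c) = \sum_i tnth x i *+ c i.
Proof.
rewrite degreeE [X in _ + X]big1 ?addr0 => [|j _]; last by rewrite widen_x_r.
by apply: eq_bigr => i _; rewrite widen_x_l.
Qed.

Lemma degree_y c : degree (widen_y c) = \sum_i tnth y i *+ c i.
Proof.
rewrite degreeE [X in X + _]big1 ?add0r => [|j _]; last by rewrite widen_y_l.
by apply: eq_bigr => i _; rewrite widen_y_r.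
Qed.

Lemma supp_inP t (c : 'X_{1..k.+1 + l.+1}) : reflect
  ((forall i, (0 < c (lshift _ i))%N -> in_quad t (tnth x i)) /\
   (forall j, (0 < c (rshift _ j))%N -> in_quad t (tnth y j))) (supp_in t c).
Proof.
apply: (iffP forallP) => [h|[h1 h2] i].
  by split=> i ci; [rewrite -gens_x|rewrite -gens_y]; exact: (implyP (h _)).
rewrite -[i]splitK; case: (split i) => i'; apply/implyP => /=.
  by rewrite gens_x; apply: h1.
by rewrite gens_y; apply: h2.
Qed.

Lemma supp_in_x c : supp_in Q1 (widen_x c).
Proof.
by apply/supp_inP; split=> [i _|j]; rewrite ?in_quad_x // widen_x_r.
Qed.

Lemma supp_in_y c : supp_in Q3 (widen_y c).
Proof.
by apply/supp_inP; split=> [i|j _]; rewrite ?in_quad_y // widen_y_l.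
Qed.

Lemma supp_in1 (c : 'X_{1..k.+1 + l.+1}) : supp_in Q1 c -> c = widen_x (restrict_x c).
Proof.
move=> /supp_inP[_ h]; apply: mnm_split => i; first by rewrite widen_x_l mnmE.
by rewrite widen_x_r; have := h i; rewrite in_quad_y; case: (c _) => // n /(_ isT).
Qed.

Lemma supp_in3 (c : 'X_{1..k.+1 + l.+1}) : supp_in Q3 c -> c = widen_y (restrict_y c).
Proof.
move=> /supp_inP[h _]; apply: mnm_split => i; last by rewrite widen_y_r mnmE.
by rewrite widen_y_l; have := h i; rewrite in_quad_x; case: (c _) => // n /(_ isT).
Qed.

(** For the index pairs (0, 0) and (k, l) these are the monomials of the planes S_0 and S_2. *)
Definition corner i0 j0 (p q : nat) : 'X_{1..k.+1 + l.+1} :=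
  (U_(lshift l.+1 i0) *+ p + U_(rshift k.+1 j0) *+ q)%MM.

Lemma corner_l i0 j0 p q i : corner i0 j0 p q (lshift _ i) = ((i == i0) * p)%N.
Proof.
rewrite mnmDE !mulmnE !mnm1E eq_sym (inj_eq (@lshift_inj _ _)).
by rewrite eq_sym [rshift _ _ == _]eq_sym eq_lrshift mul0n addn0 eq_sym.
Qed.

Lemma corner_r i0 j0 p q j : corner i0 j0 p q (rshift _ j) = ((j == j0) * q)%N.
Proof.
by rewrite mnmDE !mulmnE !mnm1E eq_lrshift mul0n add0n (inj_eq (@rshift_inj _ _)) eq_sym.
Qed.

Lemma degree_corner i0 j0 p q : degree (corner i0 j0 p q) = tnth x i0 *+ p + tnth y j0 *+ q.
Proof.
rewrite degreeE; congr (_ + _).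
  rewrite (bigD1 i0) //= corner_l eqxx mul1n big1 ?addr0 // => i /negbTE ii.
  by rewrite corner_l ii mul0n mulr0n.
rewrite (bigD1 j0) //= corner_r eqxx mul1n big1 ?addr0 // => i /negbTE ii.
by rewrite corner_r ii mul0n mulr0n.
Qed.

Lemma supp_in_corner t i0 j0 (c : 'X_{1..k.+1 + l.+1}) :
  (forall i, in_quad t (tnth x i) -> i = i0) -> (forall j, in_quad t (tnth y j) -> j = j0) ->
  supp_in t c -> c = corner i0 j0 (c (lshift _ i0)) (c (rshift _ j0)).
Proof.
move=> hx hy /supp_inP[h1 h2]; apply: mnm_split => i.
  rewrite corner_l; case: eqP => [->|ii]; first by rewrite mul1n.
  by case: (c _) (h1 i) => // n /(_ isT) /hx.
rewrite corner_r; case: eqP => [->|ii]; first by rewrite mul1n.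
by case: (c _) (h2 i) => // n /(_ isT) /hy.
Qed.

Lemma corner_supp_in t i0 j0 p q : in_quad t (tnth x i0) -> in_quad t (tnth y j0) ->
  supp_in t (corner i0 j0 p q).
Proof.
move=> h1 h2; apply/supp_inP; split=> i.
  by rewrite corner_l; case: eqP => [->|].
by rewrite corner_r; case: eqP => [->|].
Qed.

Lemma supp_in0 (c : 'X_{1..k.+1 + l.+1}) : supp_in Q0 c ->
  c = corner ord0 ord0 (c (lshift _ ord0)) (c (rshift _ ord0)).
Proof. by apply: supp_in_corner => i; rewrite ?in_quad_x ?in_quad_y => /eqP. Qed.

Lemma supp_in2 (c : 'X_{1..k.+1 + l.+1}) : supp_in Q2 c ->
  c = corner ord_max ord_max (c (lshift _ ord_max)) (c (rshift _ ord_max)).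
Proof. by apply: supp_in_corner => i; rewrite ?in_quad_x ?in_quad_y => /eqP. Qed.

Lemma chart_corner0 p q : chart Q0 (tnth x ord0 *+ p + tnth y ord0 *+ q) = (p%:Z, q%:Z).
Proof.
rewrite x_first y_first -/(ray1 r a b s Q0) -/(ray2 b s Q0) chartD !chartMn.
by rewrite chart_ray1 // chart_ray2 // !pairMnE /= !mul0rn -pairD addr0 add0r !natz.
Qed.

Lemma chart_corner2 p q : chart Q2 (tnth x ord_max *+ p + tnth y ord_max *+ q) = (p%:Z, q%:Z).
Proof.
rewrite x_last y_last -/(ray1 r a b s Q2) -/(ray2 b s Q2) chartD !chartMn.
by rewrite chart_ray1 // chart_ray2 // !pairMnE /= !mul0rn -pairD addr0 add0r !natz.
Qed.

Lemma degree_surj m : exists c, degree c = m /\ standard c.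
Proof.
have [t tm] := in_quad_cover rsab m.
have corners t' i0 j0 : (forall p q, chart t' (tnth x i0 *+ p + tnth y j0 *+ q) = (p%:Z, q%:Z)) ->
    in_quad t' (tnth x i0) -> in_quad t' (tnth y j0) -> in_quad t' m ->
    exists c, degree c = m /\ supp_in t' c.
  move=> h hx hy /andP[h1 h2].
  exists (corner i0 j0 `|(chart t' m).1|%N `|(chart t' m).2|%N); split.
    rewrite degree_corner; apply: (@chart_inj r a b s rsab t'); rewrite h.
    by rewrite !gez0_abs //; case: (chart t' m).
  exact: corner_supp_in.
suff [c [cm tc]] : exists c, degree c = m /\ supp_in t c.
  by exists c; split=> //; apply/standardP; exists t.
case: t tm => tm.
- by apply: (corners Q0 ord0 ord0 chart_corner0) => //; rewrite ?in_quad_x ?in_quad_y.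
- by have [c ->] := x_gen tm; exists (widen_x c); rewrite degree_x supp_in_x.
- by apply: (corners Q2 ord_max ord_max chart_corner2) => //; rewrite ?in_quad_x ?in_quad_y.
- by have [c ->] := y_gen tm; exists (widen_y c); rewrite degree_y supp_in_y.
Qed.

Lemma to_latticeD n m : to_lattice (n + m) = to_lattice n + to_lattice m.
Proof. by apply: injective_projections; rewrite /= PoszD. Qed.

Lemma to_latticeMn n m : to_lattice (n *+ m) = to_lattice n *+ m.
Proof. by elim: m => [|m IH]; rewrite ?mulr0n // !mulrS to_latticeD IH. Qed.

Lemma to_lattice_inj : injective to_lattice.
Proof. by move=> [n m] [n' m'] [-> ->]. Qed.

Lemma to_lattice_sum (I : Type) (t : seq I) (F : I -> nat * nat) :
  to_lattice (\sum_(i <- t) F i) = \sum_(i <- t) to_lattice (F i).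
Proof. exact: (big_morph _ to_latticeD). Qed.

Lemma chart_sum t (I : Type) (u : seq I) (F : I -> lattice) :
  chart t (\sum_(i <- u) F i) = \sum_(i <- u) chart t (F i).
Proof. exact: (big_morph _ (chartD r a b s t) (chart0 r a b s t)). Qed.

Lemma chart_x_sum (c : 'X_{1..k.+1}) :
  chart Q1 (\sum_i tnth x i *+ c i) = to_lattice (\sum_i tnth e i *+ c i).
Proof.
by rewrite chart_sum to_lattice_sum; apply: eq_bigr => i _; rewrite chartMn chart_x to_latticeMn.
Qed.

Lemma chart_y_sum (c : 'X_{1..l.+1}) :
  chart Q3 (\sum_i tnth y i *+ c i) = to_lattice (\sum_i tnth f i *+ c i).
Proof.
by rewrite chart_sum to_lattice_sum; apply: eq_bigr => i _; rewrite chartMn chart_y to_latticeMn.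
Qed.

(** By [supp_in_face] both monomials are supported on one cone. On [Q0] and [Q2] the lattice point
    determines the monomial; on [Q1] and [Q3] the difference is a binomial relation of the quotient
    singularity. *)
Lemma standard_binomial c d : standard c -> degree c = degree d -> standard d ->
  tent_ideal (K := K) e f ('X_[c] - 'X_[d]).
Proof.
move=> /standardP[t tc] cd /standardP[u ud].
have {u ud} td : supp_in t d by apply: (supp_in_face rsab ud); rewrite -cd; apply: supp_in_degree.
case: t tc td => tc td.
- move: cd; rewrite (supp_in0 tc) (supp_in0 td) !degree_corner => /(congr1 (chart Q0)).
  by rewrite !chart_corner0 => -[-> ->]; rewrite subrr; apply: ideal0.
- move: cd; rewrite (supp_in1 tc) (supp_in1 td) !degree_x => cd.
  apply: ideal_gen; constructor 1.
  exists ('X_[restrict_x c] - 'X_[restrict_x d]); last by rewrite comp_mpolyB !comp_tent_x.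
  by apply: quotient_ideal_binomial; apply: to_lattice_inj; rewrite -!chart_x_sum cd.
- move: cd; rewrite (supp_in2 tc) (supp_in2 td) !degree_corner => /(congr1 (chart Q2)).
  by rewrite !chart_corner2 => -[-> ->]; rewrite subrr; apply: ideal0.
- move: cd; rewrite (supp_in3 tc) (supp_in3 td) !degree_y => cd.
  apply: ideal_gen; constructor 2.
  exists ('X_[restrict_y c] - 'X_[restrict_y d]); last by rewrite comp_mpolyB !comp_tent_y.
  by apply: quotient_ideal_binomial; apply: to_lattice_inj; rewrite -!chart_y_sum cd.
Qed.

(** If no product x_i y_j from the equations of the tent divides the monomial, then it involves only
    x's, only y's, or only one of the pairs x_0, y_0 and x_k, y_l: in each case it is standard. *)
Lemma nonstandard_monomial c : ~~ standard c -> tent_ideal (K := K) e f 'X_[c].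
Proof.
move=> nc.
case: (boolP [exists i, exists j, [&& (0 < c (lshift l.+1 i))%N, (0 < c (rshift k.+1 j))%N,
    (i, j) != (ord0, ord0) & (i, j) != (ord_max, ord_max)]]).
  move=> /existsP[i /existsP[j /and4P[ci cj h1 h2]]].
  rewrite (_ : c = (c - U_(lshift l.+1 i) - U_(rshift k.+1 j)) +
      (U_(lshift l.+1 i) + U_(rshift k.+1 j)))%MM.
    by rewrite !mpolyXD; apply: idealMl; apply: ideal_gen; constructor 3; exists i, j.
  apply: mnm_split => i'.
    by rewrite !mnmDE !mnmBE !mnm1E [rshift _ _ == _]eq_sym eq_lrshift; case: eqP => [<-|] /=; lia.
  by rewrite !mnmDE !mnmBE !mnm1E eq_lrshift; case: eqP => [<-|] /=; lia.
rewrite negb_exists => /forallP h.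
have {}h i j : (0 < c (lshift l.+1 i))%N -> (0 < c (rshift k.+1 j))%N ->
    (i, j) = (ord0, ord0) \/ (i, j) = (ord_max, ord_max).
  move=> ci cj; have := h i; rewrite negb_exists => /forallP/(_ j).
  by rewrite ci cj /= negb_and !negbK => /orP[] /eqP ->; [left|right].
case/negP: nc; apply/standardP.
case: (pickP (fun i => 0 < c (lshift l.+1 i))%N) => [i ci|cx]; last first.
  by exists Q3; apply/supp_inP; split=> [i|j _]; rewrite ?cx ?in_quad_y.
case: (pickP (fun j => 0 < c (rshift k.+1 j))%N) => [j cj|cy]; last first.
  by exists Q1; apply/supp_inP; split=> [i' _|j]; rewrite ?cy ?in_quad_x.
have ok : (ord0 : 'I_k.+1) <> ord_max by move=> /(congr1 val) /=; lia.
have ol : (ord0 : 'I_l.+1) <> ord_max by move=> /(congr1 val) /=; lia.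
(* Once a corner pair occurs, any further variable would form a forbidden product with one of the
   two, because first and last indices differ. *)
case: (h i j ci cj) => -[ei ej]; [exists Q0|exists Q2]; apply/supp_inP; split=> [i' ci'|j' cj'];
  rewrite ?in_quad_x ?in_quad_y; apply/eqP.
- by case: (h i' j ci' cj) => -[-> //]; rewrite ej => /ol.
- by case: (h i j' ci cj') => -[+ -> //]; rewrite ei => /ok.
- by case: (h i' j ci' cj) => -[-> //]; rewrite ej => /esym/ol.
- by case: (h i j' ci cj') => -[+ -> //]; rewrite ei => /esym/ok.
Qed.

Section Kernel.
Variables (A : comAlgType K) (pi : {lrmorphism {mpoly K[k.+1 + l.+1]} -> A}) (z : lattice -> A).
Hypothesis pi0 : forall p, pi p = 0 <->
  forall m, \sum_(c <- msupp p | standard c && (degree c == m)) p@_c = 0.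
Hypothesis piX : forall c, pi 'X_[c] = if standard c then z (degree c) else 0.

(** The injective chart turns the fiber over [m] into the fiber over an exponent, where the
    coefficients of [q] sum to 0; if the chart coordinates of [m] are not natural numbers, the fiber
    is empty. *)
Lemma sum_fiber_eq0 n (w : n.+1.-tuple lattice) (d : n.+1.-tuple (nat * nat)) t
    (q : {mpoly K[n.+1]}) :
  (forall c : 'X_{1..n.+1},
    chart t (\sum_i tnth w i *+ c i) = to_lattice (\sum_i tnth d i *+ c i)) ->
  quotient_ideal d q ->
  forall m, \sum_(c <- msupp q | \sum_i tnth w i *+ c i == m) q@_c = 0.
Proof.
move=> h hq m; case: (eqVneq (chart t m) (to_lattice (absz2 (chart t m)))) => [em|nm].
  rewrite -[RHS](quotient_ideal_coeff (absz2 (chart t m)) hq); apply: eq_bigl => c.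
  rewrite -(inj_eq (@chart_inj r a b s rsab t)) h em (inj_eq to_lattice_inj).
  by congr (_ == _); rewrite -em.
rewrite big1 // => c /eqP cm; case/eqP: nm; rewrite -cm h.
by case: (\sum_i _).
Qed.

Lemma tent_equation_kernel p : tent_equation e f p -> pi p = 0.
Proof.
case=> [[q hq ->]|[q hq ->]|[i [j [h1 h2 ->]]]].
- rewrite comp_mpolyEX raddf_sum /=.
  rewrite -[RHS](sum_by_key_eq0 z (sum_fiber_eq0 chart_x_sum hq)).
  apply: eq_bigr => c _; rewrite linearZ /= comp_tent_x piX degree_x.
  by rewrite (introT (standardP _ _ _ _ _ _)) //; exists Q1; apply: supp_in_x.
- rewrite comp_mpolyEX raddf_sum /=.
  rewrite -[RHS](sum_by_key_eq0 z (sum_fiber_eq0 chart_y_sum hq)).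
  apply: eq_bigr => c _; rewrite linearZ /= comp_tent_y piX degree_y.
  by rewrite (introT (standardP _ _ _ _ _ _)) //; exists Q3; apply: supp_in_y.
- rewrite /tent_x /tent_y -mpolyXD piX; case: standardP => // -[t] /supp_inP[tx ty].
  have {}tx : in_quad t (tnth x i) by apply: tx; rewrite mnmDE mnm1E eqxx.
  have {}ty : in_quad t (tnth y j) by apply: ty; rewrite mnmDE [X in (_ + X)%N]mnm1E eqxx addn1.
  move: tx ty h1 h2; rewrite in_quad_x in_quad_y; case: t => // /eqP -> /eqP ->; by rewrite eqxx.
Qed.

Lemma tent_idealP p : pi p = 0 <-> tent_ideal e f p.
Proof.
split=> [/pi0 h|[n [c [g [hg ->]]]]]; last first.
  rewrite raddf_sum big1 //= => i _; rewrite rmorphM /= (tent_equation_kernel (hg i)).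
  exact: mulr0.
(* Each standard monomial is compared with a chosen one over the same lattice point. The chosen
   monomials cancel in total, since the coefficients over each lattice point sum to 0, and only
   binomials of the ideal remain. *)
pose rep m := proj1_sig (constructive_indefinite_description _ (degree_surj m)).
have repP m : degree (rep m) = m /\ standard (rep m).
  exact: proj2_sig (constructive_indefinite_description _ (degree_surj m)).
have e0 : \sum_(c <- [seq c <- msupp p | standard c])
    p@_c *: ('X_[rep (degree c)] : {mpoly K[k.+1 + l.+1]}) = 0.
  apply: (sum_by_key_eq0 (fun m => 'X_[rep m])) => m.
  by rewrite big_filter_cond; exact: h.
rewrite [p]mpolyE (bigID standard) /=; apply: idealD; last first.
  by apply: ideal_sum => c nc; apply: idealZ; apply: nonstandard_monomial.
move: e0; rewrite big_filter => e0.
rewrite (_ : \sum_(c <- _ | _) _ =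
    \sum_(c <- msupp p | standard c) p@_c *: ('X_[c] - 'X_[rep (degree c)]));
  last by under [RHS]eq_bigr do rewrite scalerBr; rewrite sumrB e0 subr0.
apply: ideal_sum => c sc.
apply: idealZ; have [h1 h2] := repP (degree c).
exact: standard_binomial.
Qed.
End Kernel.
End Tent.

(** * Continued fractions and linear recurrences *)

Lemma cf_mx_cons c cs : cf_mx (c :: cs) = cf_step c *m cf_mx cs.
Proof. by rewrite /cf_mx big_cons. Qed.

Lemma cf_num_nil : cf_num [::] = 1.
Proof. by rewrite /cf_num /cf_mx big_nil !mxE. Qed.

Lemma cf_den_nil : cf_den [::] = 0.
Proof. by rewrite /cf_den /cf_mx big_nil !mxE. Qed.

Lemma cf_num_cons c cs : cf_num (c :: cs) = c * cf_num cs - cf_den cs.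
Proof.
rewrite /cf_num /cf_den cf_mx_cons mxE !big_ord_recl big_ord0 !mxE /=.
by rewrite (_ : lift ord0 ord0 = ord_max); [ring | apply: val_inj].
Qed.

Lemma cf_den_cons c cs : cf_den (c :: cs) = cf_num cs.
Proof.
rewrite /cf_num /cf_den cf_mx_cons mxE !big_ord_recl big_ord0 !mxE /=.
by rewrite (_ : lift ord0 ord0 = ord_max); [ring | apply: val_inj].
Qed.

Lemma cf_den_lt_num cs : all (fun c : int => 2 <= c) cs -> 0 <= cf_den cs < cf_num cs.
Proof.
elim: cs => [_|c cs IH /= /andP[c2 /IH]]; first by rewrite cf_num_nil cf_den_nil.
by rewrite cf_num_cons cf_den_cons => /andP[? ?]; apply/andP; split; nia.
Qed.

Lemma cf_coprime cs : coprimez (cf_num cs) (cf_den cs).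
Proof.
elim: cs => [|c cs /coprimezP[[u v] /= IH]]; first by rewrite cf_num_nil cf_den_nil.
rewrite cf_num_cons cf_den_cons; apply/coprimezP; exists (- v, u + v * c) => /=.
by rewrite -IH; ring.
Qed.

(** Euclid's algorithm with quotients rounded up: r = (d + 1) q - (q - t), where 0 < q - t < q as
    long as t > 0. For t = 0 coprimality forces q = 1, and the expansion is the single entry r. *)
Lemma cf_exists (r q : nat) : (q < r)%N -> coprime r q ->
  exists cs : seq int, [/\ all (fun c => 2 <= c) cs, cf_num cs = r & cf_den cs = q].
Proof.
elim/ltn_ind: r q => r IH q qr co.
case: (posnP q) => [q0|q0].
  exists [::]; rewrite cf_num_nil cf_den_nil q0; split=> //.
  by move: co; rewrite q0 /coprime gcdn0 => /eqP ->.
have := divn_eq r q; set d := (r %/ q)%N; set t := (r %% q)%N => e.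
have tq : (t < q)%N by rewrite ltn_mod.
case: (posnP t) => [t0|t0].
  have q1 : q = 1%N.
    move: co; rewrite e t0 addn0 coprimeMl => /andP[_].
    by rewrite /coprime gcdnn => /eqP.
  by exists [:: r%:Z]; rewrite cf_num_cons cf_den_cons cf_num_nil cf_den_nil q1; split=> //=; lia.
have [||cs [h1 h2 h3]] := IH q qr (q - t)%N; first lia.
  have /coprimezP[[u v] /= uv] : coprimez r%:Z q%:Z by [].
  suff : coprimez q%:Z (q - t)%N%:Z by [].
  apply/coprimezP; exists (u * (d%:Z + 1) + v, - u) => /=.
  by rewrite -[RHS]uv -subzn ?(ltnW tq) // e PoszD PoszM; ring.
exists (d.+1%:Z :: cs); rewrite cf_num_cons cf_den_cons h2 h3; split=> //; last first.
  by rewrite e -subzn ?(ltnW tq) // PoszD PoszM -addn1 PoszD; ring.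
by rewrite /= h1 andbT; nia.
Qed.

(** The denominator is only claimed modulo r: for r = 1 the empty expansion has denominator 0,
    whereas r - alpha = 1. The lattice of invariant exponents depends on no more than this
    residue. *)
Lemma cf_expansionP (r alpha : nat) (cs : seq int) :
  cyclic_quotient_type r alpha -> cf_expansion r (r - alpha) cs ->
  [/\ all (fun c => 2 <= c) cs, cf_num cs = r & exists t, cf_den cs + alpha%:Z = r%:Z * t].
Proof.
case=> r0 co h2 h1 []; case: cs => [_ r1|c cs hall].
  rewrite cf_num_nil cf_den_nil r1; split=> //; exists alpha%:Z; ring.
have /andP[d0 dn] := cf_den_lt_num hall.
have dpos : 0 < cf_den (c :: cs).
  by rewrite cf_den_cons; move: hall => /= /andP[_ /cf_den_lt_num]; lia.
have ar : (alpha < r)%N.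
  by case: (ltnP 1 r) => [/h2 /andP[]//|r1]; rewrite h1; lia.
have := cf_coprime (c :: cs); rewrite /cfrac.
move: (cf_num _) (cf_den _) d0 dn dpos => p q d0 dn dpos cpq.
have ra0 : ((r - alpha)%:R : rat) != 0 by rewrite pnatr_eq0; lia.
have q0 : (q%:~R : rat) != 0 by rewrite intr_eq0; lia.
move/eqP; rewrite -[r%:R]/(r%:Z%:~R) -[(r - alpha)%:R]/((r - alpha)%:Z%:~R).
rewrite eqr_div // -!intrM eqr_int => /eqP e.
have cra : coprimez r%:Z (r - alpha)%:Z.
  have /coprimezP[[u v] /= uv] : coprimez alpha%:Z r%:Z by [].
  by apply/coprimezP; exists (u + v, - u) => /=; rewrite -[RHS]uv -subzn ?(ltnW ar) //; ring.
(* Both fractions are reduced, so their numerators divide each other. *)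
have pr : (p %| r%:Z)%Z by rewrite -(Gauss_dvdzl _ cpq) e dvdz_mulr.
have rp : (r%:Z %| p)%Z by rewrite -(Gauss_dvdzl _ cra) -e dvdz_mulr.
have erp : p = r%:Z.
  case/dvdzP: pr => u hu; case/dvdzP: rp => v hv.
  have e1 : v * u * p = p by rewrite -mulrA -hu -hv.
  have p0 : p != 0 by lia.
  have : v * u = 1 by apply: (mulIf p0); rewrite mul1r.
  move=> vu; have u0 : 0 < u by nia.
  have v0 : 0 < v by nia.
  have u1 : u = 1 by nia.
  by rewrite hu u1 mul1r.
split=> //; exists 1; rewrite mulr1; move: e; rewrite erp.
have -> : (r - alpha)%:Z = r%:Z - alpha%:Z by rewrite -subzn ?(ltnW ar).
nia.
Qed.

Lemma cf_expansion_exists (r alpha : nat) : cyclic_quotient_type r alpha ->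
  exists cs : seq int, cf_expansion r (r - alpha) cs.
Proof.
case=> r0 co h2 h1; case: (ltnP 1 r) => [r1|r1]; last first.
  by exists [::]; split=> //; lia.
have /andP[a0 ar] := h2 r1.
have [||cs [hall hn hd]] := @cf_exists r (r - alpha); first lia.
  have /coprimezP[[u v] /= uv] : coprimez alpha%:Z r%:Z by [].
  suff : coprimez r%:Z (r - alpha)%:Z by [].
  by apply/coprimezP; exists (u + v, - u) => /=; rewrite -[RHS]uv -subzn ?(ltnW ar) //; ring.
exists cs; split=> //; rewrite /cfrac hn hd; case: cs hall hn hd => // _.
by rewrite cf_num_nil => -[].
Qed.

Definition chain n (c : nat -> int) (h : nat -> int) :=
  forall i, (i < n)%N -> h i + h i.+2 = c i * h i.+1.

Definition lchain n (c : nat -> int) (h : nat -> lattice) :=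
  forall i, (i < n)%N -> h i + h i.+2 = h i.+1 *~ c i.

(** The recurrence reads h (i+2) - h (i+1) = (h (i+1) - h i) + (c i - 2) h (i+1): with tags at least
    2, the differences do not decrease while h is nonnegative. *)
Lemma chain_convex n c h : (forall i, (i < n)%N -> 2 <= c i) -> chain n c h ->
  0 <= h 0%N -> h 0%N <= h 1%N -> forall i, (i <= n)%N ->
  0 <= h i /\ h 1%N - h 0%N <= h i.+1 - h i.
Proof.
move=> c2 ch h0 h1; elim=> [|i IH] // ilt.
have [IH1 IH2] := IH (ltnW ilt); have := c2 i ilt; have := ch i ilt.
move: (c i) (h i) (h i.+1) (h i.+2) IH1 IH2 => C u v w; nia.
Qed.

Lemma chain_shift n c h t : (t <= n)%N -> chain n c h ->
  chain (n - t) (fun i => c (t + i)%N) (fun i => h (t + i)%N).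
Proof. by move=> tn ch i it; rewrite !addnS; apply: ch; lia. Qed.

Lemma chain_rev n c h t : (t <= n)%N -> chain n c h ->
  chain t (fun i => c (t - i.+1)%N) (fun i => h (t.+1 - i)%N).
Proof.
move=> tn ch i it; rewrite addrC.
have -> : (t.+1 - i = (t - i.+1).+2)%N by lia.
have -> : (t.+1 - i.+1 = (t - i.+1).+1)%N by lia.
have -> : (t.+1 - i.+2 = t - i.+1)%N by lia.
by apply: ch; lia.
Qed.

Lemma chain_mono n c h : (forall i, (i < n)%N -> 2 <= c i) -> chain n c h ->
  0 <= h 0%N -> h 0%N <= h 1%N -> forall i, (i <= n.+1)%N -> h 0%N <= h i.
Proof.
move=> c2 ch h0 h1; elim=> [|i IH] // i_n.
have [_] := chain_convex c2 ch h0 h1 i_n; have := IH (ltnW i_n); lia.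
Qed.

(** From the plateau [h t = h t.+1] convexity gives growth to the right, and to the left after
    reversing the chain. *)
Lemma chain_ge n c h t : (forall i, (i < n)%N -> 2 <= c i) -> chain n c h ->
  (t <= n)%N -> 0 <= h t -> h t = h t.+1 -> forall i, (i <= n.+1)%N -> h t <= h i.
Proof.
move=> c2 ch tn h0 ht i i_n; case: (leqP t i) => ti.
  have /= := chain_mono _ (chain_shift tn ch) _ _ (i := (i - t)%N).
  rewrite addn0 addn1 subnKC // -ht; apply=> //; last by lia.
  by move=> j hj; apply: c2; lia.
have /= := chain_mono _ (chain_rev tn ch) _ _ (i := (t.+1 - i)%N).
rewrite subn0 subn1 subKn /= -?ht; last by lia.
apply=> //; last by lia.
by move=> j hj; apply: c2; lia.
Qed.

(** Started at numerator and denominator, the recurrence strips the continued fraction one entry at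
    a time, down to 1/0 for the empty one. *)
Lemma chain_end cs h : chain (size cs) (nth 0 cs) h ->
  h 0%N = cf_num cs -> h 1%N = cf_den cs -> h (size cs) = 1 /\ h (size cs).+1 = 0.
Proof.
elim: cs h => [|c cs IH] h ch h0 h1.
  by rewrite /= h0 h1 cf_num_nil cf_den_nil.
apply: (IH (fun i => h i.+1)).
- by move=> i ilt; apply: (ch i.+1).
- by rewrite h1 cf_den_cons.
- by have := ch 0%N isT; rewrite h0 h1 cf_num_cons cf_den_cons /=; lia.
Qed.

Lemma wedgeDl u v w : wedge (u + v) w = wedge u w + wedge v w.
Proof. rewrite /wedge /=; ring. Qed.

Lemma wedgeDr u v w : wedge u (v + w) = wedge u v + wedge u w.
Proof. rewrite /wedge /=; ring. Qed.

Lemma wedgexx u : wedge u u = 0.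
Proof. rewrite /wedge; ring. Qed.

Lemma wedgeC u v : wedge u v = - wedge v u.
Proof. rewrite /wedge; ring. Qed.

Lemma pairMzE (v : lattice) (c : int) : v *~ c = (v.1 * c, v.2 * c).
Proof.
have nat_case (w : lattice) n : w *~ n%:Z = (w.1 * n%:Z, w.2 * n%:Z).
  by rewrite -pmulrn pairMnE -!mulrzz.
case: c => n; first exact: nat_case.
by rewrite NegzE mulrNz nat_case !mulrN.
Qed.

Lemma wedgeMzr u v c : wedge u (v *~ c) = c * wedge u v.
Proof. rewrite pairMzE /wedge /=; ring. Qed.

Lemma wedgeMzl u v c : wedge (u *~ c) v = c * wedge u v.
Proof. rewrite pairMzE /wedge /=; ring. Qed.

Lemma lchain_functional n c h (L : lattice -> int) :
  (forall u v, L (u + v) = L u + L v) -> (forall u d, L (u *~ d) = d * L u) ->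
  lchain n c h -> chain n c (fun i => L (h i)).
Proof. by move=> LD LM ch i it; rewrite -LD ch // LM. Qed.

Lemma lchain_wedge n c h : lchain n c h ->
  forall i, (i <= n)%N -> wedge (h i) (h i.+1) = wedge (h 0%N) (h 1%N).
Proof.
move=> ch; elim=> [|i IH] // ilt; rewrite -IH ?(ltnW ilt) //.
have -> : h i.+2 = h i.+1 *~ c i - h i by rewrite -ch // addrC addKr.
rewrite wedgeDr wedgeMzr wedgexx mulr0 add0r /wedge /=; ring.
Qed.

(** The second equation is there for the induction: the denominator of a list is the numerator of
    its tail. *)
Lemma lchain_cf cs h : lchain (size cs) (nth 0 cs) h ->
  wedge (h 0%N) (h (size cs).+1) = cf_num cs * wedge (h 0%N) (h 1%N) /\
  wedge (h 1%N) (h (size cs).+1) = cf_den cs * wedge (h 0%N) (h 1%N).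
Proof.
elim: cs h => [|c cs IH] h ch.
  by rewrite cf_num_nil cf_den_nil /= wedgexx mul1r mul0r.
have [|h1 h2] := IH (fun i => h i.+1); first by move=> i ilt; apply: (ch i.+1).
have w12 : wedge (h 1%N) (h 2%N) = wedge (h 0%N) (h 1%N) by apply: (lchain_wedge ch (i := 1%N)).
rewrite cf_den_cons cf_num_cons /= h1 w12; split=> //.
have {1}-> : h 0%N = h 1%N *~ c - h 2%N by rewrite -(ch 0%N) // addrK.
have -> : h 1%N *~ c - h 2%N = h 1%N *~ c + h 2%N *~ (-1) by rewrite mulrNz mulr1z.
by rewrite wedgeDl !wedgeMzl h1 h2 w12; ring.
Qed.

(** * Hirzebruch-Jung generators of a cyclic quotient *)

Fixpoint chain_seq (u v : lattice) (cs : seq int) : seq lattice :=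
  u :: if cs is c :: cs' then chain_seq v (v *~ c - u) cs' else [:: v].

Lemma chain_seq0 u v cs : (chain_seq u v cs)`_0 = u.
Proof. by case: cs. Qed.

Lemma chain_seq1 u v cs : (chain_seq u v cs)`_1 = v.
Proof. by case: cs => //= c cs; rewrite chain_seq0. Qed.

Lemma chain_seqP u v cs : lchain (size cs) (nth 0 cs) (nth 0 (chain_seq u v cs)).
Proof.
elim: cs u v => //= c cs IH u v [_|i ilt]; last exact: IH.
by rewrite /= chain_seq0 chain_seq1 addrC subrK.
Qed.

Lemma lchain_uniq n c h h' : lchain n c h -> lchain n c h' ->
  h 0%N = h' 0%N -> h 1%N = h' 1%N -> forall i, (i <= n.+1)%N -> h i = h' i.
Proof.
move=> ch ch' e0 e1; elim/ltn_ind=> -[//|[//|i]] IH i_n.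
have -> : h i.+2 = h i.+1 *~ c i - h i by rewrite -ch // addrC addKr.
have -> : h' i.+2 = h' i.+1 *~ c i - h' i by rewrite -ch' // addrC addKr.
by rewrite !IH //; lia.
Qed.

(** * Generating families of commutative monoids *)

Section Spans.
Variables (V : nmodType) (g : seq V).
Definition spans (v : V) := exists c : nat -> nat, v = \sum_(i < size g) g`_i *+ c i.

Lemma spansD u v : spans u -> spans v -> spans (u + v).
Proof.
move=> [c ->] [d ->]; exists (fun i => c i + d i)%N; rewrite -big_split /=.
by apply: eq_bigr => i _; rewrite mulrnDr.
Qed.

Lemma spansMn u n : spans u -> spans (u *+ n).
Proof.
move=> [c ->]; exists (fun i => c i * n)%N; rewrite -sumrMnl.
by apply: eq_bigr => i _; rewrite mulrnA.
Qed.

Lemma spans_nth i : (i < size g)%N -> spans g`_i.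
Proof.
move=> ig; exists (fun j => (j == i) : nat); rewrite (bigD1 (Ordinal ig)) //= eqxx mulr1n.
rewrite big1 ?addr0 // => j /negbTE ji.
by rewrite (_ : (j == i :> nat) = false) ?mulr0n.
Qed.
End Spans.

(** Serves to show that an indecomposable element belongs to every generating family: a nonzero
    generator splits off, and the rest must be 0. *)
Lemma spans_term (V : nmodType) (M : V -> Prop) (h : seq V) v :
  (forall u, u \in h -> M u) -> M 0 -> (forall u w, M u -> M w -> M (u + w)) ->
  spans h v -> v <> 0 -> exists2 u, u \in h /\ u <> 0 & exists2 w, M w & v = u + w.
Proof.
move=> hM M0 MD [c ->].
have Mn u n : M u -> M (u *+ n).
  by move=> Mu; elim: n => [|n IH]; rewrite ?mulr0n // mulrS; apply: MD.
case: (pickP (fun i : 'I_(size h) => (0 < c i)%N && (h`_i != 0))) => [i /andP[ci /eqP hi] _|h0 []].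
  exists h`_i; first by split=> //; apply: mem_nth.
  rewrite (bigD1 i) //=; case: (c i) ci => // n _.
  exists (h`_i *+ n + \sum_(j < size h | j != i) h`_j *+ c j); last by rewrite mulrS addrA.
  apply: (MD); first by apply: Mn; apply: (hM); apply: mem_nth.
  by apply: big_ind; [exact: M0|exact: MD|move=> j _; apply: Mn; apply: hM; apply: mem_nth].
rewrite big1 // => i _; move: (h0 i); case: (posnP (c i)) => [->|_] //=.
by move=> /negbFE/eqP ->; rewrite mul0rn.
Qed.

Section Transport.
Variables (V W : nmodType) (phi : V -> W) (M : V -> Prop) (N : W -> Prop).
Hypotheses (phi0 : phi 0 = 0) (phiD : forall u v, phi (u + v) = phi u + phi v).
Hypotheses (phi_inj : injective phi) (phiM : forall w, N w <-> exists2 v, M v & phi v = w).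

Lemma generates_map g : generates M g <-> generates N (map phi g).
Proof.
have phiMn v n : phi (v *+ n) = phi v *+ n.
  by elim: n => [|n IH]; rewrite ?mulr0n // !mulrS phiD IH.
have phi_sum (c : nat -> nat) : phi (\sum_(i < size g) g`_i *+ c i) =
    \sum_(i < size (map phi g)) (map phi g)`_i *+ c i.
  rewrite size_map (big_morph phi phiD phi0); apply: eq_bigr => i _.
  by rewrite phiMn (nth_map 0).
split=> -[h1 h2]; split.
- by move=> w /mapP[v vg ->]; apply/phiM; exists v => //; apply: h1.
- move=> w /phiM[v /h2[c ->] <-]; exists c; exact: phi_sum.
- by move=> v vg; have /phiM[u uM /phi_inj <-] := h1 _ (map_f phi vg).
- move=> v vM; have /h2[c e] : N (phi v) by apply/phiM; exists v.
  by exists c; apply: phi_inj; rewrite phi_sum.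
Qed.

Lemma minimal_generators_map g :
  minimal_generators M g <-> minimal_generators N (map phi g).
Proof.
split=> -[/generates_map h1 h2]; split=> // g'.
  move=> /subseqP[m _ ->]; rewrite -map_mask => /generates_map gm.
  by rewrite (h2 _ _ gm) // mask_subseq.
move=> sg /generates_map gg; apply: (inj_map phi_inj); apply: h2 => //.
exact: map_subseq.
Qed.
End Transport.

Lemma minimal_generators_ext (V : nmodType) (M N : V -> Prop) g :
  (forall v, M v <-> N v) -> minimal_generators M g -> minimal_generators N g.
Proof.
move=> h; rewrite (minimal_generators_map (phi := id) (N := N)) ?map_id //.
by move=> w; rewrite -h; split=> [|[v ? <-]//]; exists w.
Qed.

Section HirzebruchJung.
Variables (r alpha : nat) (cs : seq int).
Hypotheses (r0 : (0 < r)%N) (cs2 : all (fun c => 2 <= c) cs).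
Hypotheses (cs_num : cf_num cs = r) (cs_den : exists t, cf_den cs + alpha%:Z = r%:Z * t).
Local Notation n := (size cs).

(* The generators are numbered from v^r = (0, r) to u^r = (r, 0), opposite to the
   order of the x_i; hj_gens below restores that order. *)
Definition hj_point (i : nat) : lattice :=
  nth 0 (chain_seq (0, cf_num cs) (1, cf_den cs) cs) i.
Local Notation G := hj_point.

Lemma hj0 : G 0%N = (0, r%:Z). Proof. by rewrite /G chain_seq0 cs_num. Qed.

Lemma hj1 : G 1%N = (1, cf_den cs). Proof. exact: chain_seq1. Qed.

Lemma hj_chain : lchain n (nth 0 cs) G.
Proof. exact: chain_seqP. Qed.

Lemma cs_ge2 i : (i < n)%N -> 2 <= nth 0 cs i.
Proof. by move=> ilt; apply: (allP cs2); apply: mem_nth. Qed.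

Lemma hj_chain_fst : chain n (nth 0 cs) (fun i => (G i).1).
Proof.
by apply: (lchain_functional (L := fst)) hj_chain => // *; rewrite pairMzE /= mulrC.
Qed.

Lemma hj_chain_snd : chain n (nth 0 cs) (fun i => (G i).2).
Proof.
by apply: (lchain_functional (L := snd)) hj_chain => // *; rewrite pairMzE /= mulrC.
Qed.

Lemma hj_wedge i : (i <= n)%N -> wedge (G i) (G i.+1) = - r%:Z.
Proof. by move=> i_n; rewrite (lchain_wedge hj_chain) // hj0 hj1 /wedge /=; ring. Qed.

Lemma hj_snd_end : (G n).2 = 1 /\ (G n.+1).2 = 0.
Proof. by apply: chain_end hj_chain_snd _ _; rewrite ?hj0 ?hj1 // cs_num. Qed.

Lemma hj_last : G n.+1 = (r%:Z, 0).
Proof.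
have [h1 h2] := hj_snd_end.
move: (hj_wedge (leqnn n)); rewrite /wedge h1 h2.
case: (G n.+1) h2 => u v /= -> ?; congr pair; lia.
Qed.

Lemma hj_fst_step i : (i <= n)%N -> 0 <= (G i).1 /\ (G i).1 < (G i.+1).1.
Proof.
move=> i_n; have := chain_convex cs_ge2 hj_chain_fst _ _ i_n.
by rewrite hj0 hj1 /= => /(_ isT isT)[-> ?]; split=> //; lia.
Qed.

Lemma hj_fst_ge0 i : (i <= n.+1)%N -> 0 <= (G i).1.
Proof.
case: i => [|i] i_n; first by rewrite hj0.
by have [? ?] := hj_fst_step i_n; lia.
Qed.

(** Read backwards from its end values 0 and 1, the second coordinate is a convex chain like the
    first. *)
Lemma hj_snd_step i : (i <= n)%N -> 0 <= (G i.+1).2 /\ (G i.+1).2 < (G i).2.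
Proof.
move=> i_n; have [e1 e0] := hj_snd_end.
have c2 j : (j < n)%N -> 2 <= nth 0 cs (n - j.+1) by move=> jn; apply: cs_ge2; lia.
have := chain_convex c2 (chain_rev (leqnn n) hj_chain_snd).
rewrite /= subn0 subn1 /= e1 e0 => /(_ isT isT (n - i)%N (leq_subr _ _)).
rewrite (_ : n.+1 - (n - i) = i.+1)%N; last by lia.
rewrite (_ : n.+1 - (n - i).+1 = i)%N; last by lia.
by move=> [? ?]; split=> //; lia.
Qed.

Lemma hj_snd_ge0 i : (i <= n.+1)%N -> 0 <= (G i).2.
Proof.
case: i => [|i] i_n; first by rewrite hj0.
by have [? ?] := hj_snd_step i_n; lia.
Qed.

Definition in_lattice (m : lattice) : Prop := exists t, alpha%:Z * m.1 + m.2 = r%:Z * t.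

Lemma hj_in_lattice i : (i <= n.+1)%N -> in_lattice (G i).
Proof.
elim/ltn_ind: i => -[|[|i]] IH i_n.
- by exists 1; rewrite hj0 /=; ring.
- by have [t e] := cs_den; exists t; rewrite hj1 /= -e; ring.
have -> : G i.+2 = G i.+1 *~ nth 0 cs i - G i.
  by rewrite -(hj_chain (i := i)) // addrC addKr.
have [||t1 e1] := IH i.+1; try lia.
have [||t0 e0] := IH i; try lia.
exists (t1 * nth 0 cs i - t0); rewrite pairMzE /=.
transitivity (r%:Z * t1 * nth 0 cs i - r%:Z * t0); last by ring.
by rewrite -e0 -e1; ring.
Qed.

Lemma in_lattice_wedge u v : in_lattice u -> in_lattice v -> exists t, wedge u v = r%:Z * t.
Proof.
move=> [t e] [t' e']; exists (u.1 * t' - v.1 * t); rewrite /wedge.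
transitivity (u.1 * (r%:Z * t') - v.1 * (r%:Z * t)); last by ring.
by rewrite -e -e'; ring.
Qed.

Definition inv_exponent (m : nat * nat) : Prop := in_lattice (to_lattice m).

Lemma inv_exponentD u v : inv_exponent u -> inv_exponent v -> inv_exponent (u + v).
Proof.
by move=> [t e] [t' e']; exists (t + t'); rewrite mulrDr -e -e' /= !PoszD; ring.
Qed.

Lemma inv_exponent0 : inv_exponent 0.
Proof. by exists 0; rewrite /=; ring. Qed.

Definition hj_nat i : nat * nat := absz2 (G i).

Lemma to_lattice_hj i : (i <= n.+1)%N -> to_lattice (hj_nat i) = G i.
Proof.
move=> i_n; have := hj_fst_ge0 i_n; have := hj_snd_ge0 i_n.
by rewrite /hj_nat /to_lattice /=; case: (G i) => u v /= *; rewrite !gez0_abs.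
Qed.

(** The angles between consecutive points fill the quadrant. Such a pair has determinant [-r], while
    the determinant of any two invariant exponents is a multiple of [r], so the coefficients given
    by Cramer's rule are integers. *)
Lemma hj_decompose m : inv_exponent m -> exists t p q : nat,
  (t <= n)%N /\ m = hj_nat t *+ p + hj_nat t.+1 *+ q.
Proof.
move=> mM; set v := to_lattice m.
(* The wedge of [G i] with [v] starts nonpositive and ends nonnegative; [t] is a place where it
   changes sign. *)
have [t [tn ut ut1]] : exists t, [/\ (t <= n)%N, wedge (G t) v <= 0 & 0 <= wedge (G t.+1) v].
  have u0 : wedge (G 0%N) v <= 0 by rewrite hj0 /wedge /=; nia.
  have : 0 <= wedge (G n.+1) v by rewrite hj_last /wedge /=; nia.
  elim: (n) u0 => [|N IH] u0 uN; first by exists 0%N.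
  case: (lerP (wedge (G N.+1) v) 0) => uN1; first by exists N.+1.
  by have [|t [tN h1 h2]] := IH u0; [lia | exists t; split=> //; lia].
have [p' ep] := in_lattice_wedge (hj_in_lattice (i := t.+1) tn) mM.
have [q' eq] := in_lattice_wedge (hj_in_lattice (leqW tn)) mM.
have rpos : 0 < r%:Z by [].
have p0 : 0 <= p' by rewrite -/v in ep; nia.
have q0 : q' <= 0 by rewrite -/v in eq; nia.
exists t, `|p'|%N, `|q'|%N; split=> //; apply: to_lattice_inj.
rewrite to_latticeD !to_latticeMn !to_lattice_hj //; last by lia.
rewrite -/v; have := hj_wedge tn; move: ep eq; rewrite -/(to_lattice m) -/v.
rewrite !pmulrn gez0_abs // lez0_abs // !pairMzE.
rewrite /wedge => ep eq ew.
have r1 : r%:Z != 0 by lia.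
clearbody v.
apply: injective_projections => /=; apply: (mulfI r1).
  transitivity ((G t).1 * (r%:Z * p') - (G t.+1).1 * (r%:Z * q')); last by ring.
  by rewrite -ep -eq -[r%:Z]opprK -ew; ring.
transitivity ((G t).2 * (r%:Z * p') - (G t.+1).2 * (r%:Z * q')); last by ring.
by rewrite -ep -eq -[r%:Z]opprK -ew; ring.
Qed.

Lemma hj_generates_mem h i : (i <= n.+1)%N -> generates inv_exponent h -> hj_nat i \in h.
Proof.
move=> i_n [hM hgen].
have [t [tn it]] : exists t, (t <= n)%N /\ (i = t \/ i = t.+1).
  by case: (leqP i n) => ?; [exists i | exists n]; split=> //; lia.
(* L equals r at G t and G t.+1, and is at least r on all points by convexity, so
   that hj_nat i is not a sum of two nonzero invariant exponents. *)
pose L v := - (wedge v (G t.+1) + wedge (G t) v).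
have LD u v : L (u + v) = L u + L v by rewrite /L wedgeDl wedgeDr; ring.
have LZ u d : L (u *~ d) = d * L u by rewrite /L wedgeMzl wedgeMzr; ring.
have Lt : L (G t) = r by rewrite /L wedgexx hj_wedge //; ring.
have Lt1 : L (G t.+1) = r by rewrite /L wedgexx hj_wedge //; ring.
have LG j : (j <= n.+1)%N -> r%:Z <= L (G j).
  have := chain_ge cs_ge2 (lchain_functional LD LZ hj_chain) tn.
  by rewrite Lt Lt1 => /(_ isT erefl); apply.
have Lr m : inv_exponent m -> m <> 0 -> r%:Z <= L (to_lattice m).
  move=> /hj_decompose[t' [p [q [t'n ->]]]] m0.
  rewrite to_latticeD !to_latticeMn !to_lattice_hj ?(leqW t'n) // LD !pmulrn !LZ.
  have := LG t' (leqW t'n); have := LG t'.+1 t'n.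
  have : (0 < p + q)%N.
    by case: p q m0 => [|p] [|q] // []; rewrite !mulr0n addr0.
  move: (L _) (L _) => a b; nia.
have iM : inv_exponent (hj_nat i) by rewrite /inv_exponent to_lattice_hj //; apply: hj_in_lattice.
have Li : L (G i) = r by case: it => ->.
have i0 : hj_nat i <> 0.
  move=> e; have := to_lattice_hj i_n; rewrite e => e'; move: Li.
  by rewrite -e' /L /wedge /=; lia.
have [u [uh u0] [w wM e]] := spans_term hM inv_exponent0 inv_exponentD (hgen _ iM) i0.
suff w0 : w = 0 by rewrite e w0 addr0.
have sum : L (to_lattice u) + L (to_lattice w) = r.
  by rewrite -LD -to_latticeD -e to_lattice_hj.
have /negbNE/eqP w0 : ~~ (w != 0).
  apply/negP => /eqP w0; have := Lr w wM w0; have := Lr u (hM _ uh) u0; lia.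
exact: w0.
Qed.

Definition hj_gens : seq (nat * nat) := rev (mkseq hj_nat n.+2).

Lemma size_hj_gens : size hj_gens = n.+2.
Proof. by rewrite size_rev size_mkseq. Qed.

Lemma nth_hj_gens i : (i <= n.+1)%N -> hj_gens`_i = hj_nat (n.+1 - i).
Proof.
by move=> i_n; rewrite nth_rev size_mkseq // nth_mkseq ?subSS //; lia.
Qed.

Lemma hj_gens_generates : generates inv_exponent hj_gens.
Proof.
split=> [v|v /hj_decompose[t [p [q [tn ->]]]]].
  rewrite mem_rev => /mapP[i]; rewrite mem_iota => /andP[_ i_n] ->.
  by rewrite /inv_exponent to_lattice_hj //; apply: hj_in_lattice.
have sp i : (i <= n.+1)%N -> spans hj_gens (hj_nat i).
  move=> i_n; rewrite -(subKn i_n) -nth_hj_gens; last by lia.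
  by apply: spans_nth; rewrite size_hj_gens; lia.
by apply: spansD; apply: spansMn; apply: sp; lia.
Qed.

(** Every generating family contains the points of [hj_gens], and both lists are sorted the same
    way, so [hj_gens] is a subsequence of [e] that already generates; minimality forces equality. *)
Lemma hj_gens_unique (e : seq (nat * nat)) : minimal_generators inv_exponent e ->
  sorted [rel d d' : nat * nat | (d'.1 < d.1)%N] e -> e = hj_gens.
Proof.
move=> [eg emin] es; apply/esym; apply: emin; last exact: hj_gens_generates.
rewrite (_ : hj_gens = [seq g <- e | g \in hj_gens]) ?filter_subseq //.
have tr : transitive [rel d d' : nat * nat | (d'.1 < d.1)%N] by move=> u v w /=; lia.
apply: (irr_sorted_eq tr).
- by move=> u /=; rewrite ltnn.
- rewrite rev_sorted; apply/(sortedP 0) => i; rewrite size_mkseq => i_n.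
  rewrite !nth_mkseq //; last by lia.
  have [? ?] : 0 <= (G i).1 /\ (G i).1 < (G i.+1).1 by apply: hj_fst_step; lia.
  by rewrite /hj_nat /=; lia.
- exact: sorted_filter.
move=> v; rewrite mem_filter andb_idr // mem_rev => /mapP[i].
by rewrite mem_iota => /andP[_ i_n] ->; apply: hj_generates_mem.
Qed.
End HirzebruchJung.

Section Quotient.
Variables (K : fieldType) (r alpha : nat) (eps : K).

(** The root of unity enters through its order alone: the action multiplies a monomial by a power of
    [eps], which is 1 exactly when [r] divides the exponent of that power. *)
Lemma invariant_monomialP (e : nat * nat) : r.-primitive_root eps ->
  invariant_monomial eps alpha e <-> inv_exponent r alpha e.
Proof.
move=> prim; rewrite /invariant_monomial /cyclic_action.
have -> : monomial K e \mPo [tuple eps ^+ alpha *: var_u K; eps *: var_v K] =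
    eps ^+ (alpha * e.1 + e.2) *: monomial K e.
  rewrite /monomial rmorphM !rmorphXn /= !comp_mpolyXU /=.
  by rewrite !exprZn -scalerAl -scalerAr scalerA -exprM -exprD.
have e1 : eps ^+ (alpha * e.1 + e.2) = 1 <-> inv_exponent r alpha e.
  split=> [/eqP|[t et]].
    rewrite -(prim_order_dvd prim) => /dvdnP[t et]; exists t%:Z.
    by rewrite /= -PoszM -PoszD et PoszM mulrC.
  apply/eqP; rewrite -(prim_order_dvd prim).
  have : (r%:Z %| (alpha * e.1 + e.2)%N%:Z)%Z by rewrite PoszD PoszM et dvdz_mulr.
  by [].
rewrite -e1; split=> [h|->]; last by rewrite scale1r.
have := congr1 (mcoeff (uv_exponent e)) h.
by rewrite mcoeffZ mcoeff_monomial eqxx mulr1.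
Qed.

Lemma quotient_generators_min k (e : k.+1.-tuple (nat * nat)) :
  r.-primitive_root eps -> quotient_generators r alpha eps e ->
  minimal_generators (inv_exponent r alpha) e.
Proof.
by move=> prim [h _]; apply: minimal_generators_ext h => v; apply: invariant_monomialP.
Qed.

Lemma quotient_generatorsE (cs : seq int) k (e : k.+1.-tuple (nat * nat)) :
  r.-primitive_root eps -> (0 < r)%N ->
  all (fun c => 2 <= c) cs -> cf_num cs = r ->
  (exists t, cf_den cs + alpha%:Z = r%:Z * t) ->
  quotient_generators r alpha eps e -> e = hj_gens cs :> seq _.
Proof.
move=> prim r0 cs2 cn cd qe; have [_ [_ _ es]] := qe.
exact: (hj_gens_unique r0 cs2 cn cd (quotient_generators_min prim qe) es).
Qed.
End Quotient.

(** * The cycle of monomials around the fan *)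

Lemma size_upto a m n : size (upto a m n) = (n.+1 - m)%N.
Proof. by rewrite size_map size_iota. Qed.

Lemma size_downto a n m : size (downto a n m) = (n.+1 - m)%N.
Proof. by rewrite size_rev size_upto. Qed.

Lemma nth_upto a m n j : (j < n.+1 - m)%N -> nth 0 (upto a m n) j = a (m + j)%N.
Proof. by move=> h; rewrite (nth_map 0%N) ?size_iota // nth_iota. Qed.

Lemma nth_downto a n m j : (j < n.+1 - m)%N -> nth 0 (downto a n m) j = a (n - j)%N.
Proof.
by move=> h; rewrite nth_rev size_upto // nth_upto; [congr a; lia|lia].
Qed.

Lemma cycle_cf (k l : nat) (x y : nat -> lattice) (ta tb : nat -> int) :
  (0 < k)%N -> (0 < l)%N ->
  (forall i, (0 < i < k)%N -> x i.-1 + x i.+1 = x i *~ ta i) ->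
  (forall j, (0 < j < l)%N -> y j.-1 + y j.+1 = y j *~ tb j) ->
  x k.-1 + y l = x k *~ ta k -> y l.-1 + x k = y l *~ tb l ->
  wedge (x 1%N) (y 0%N) =
    cf_num (upto ta 2 k ++ downto tb l 1) * wedge (x 0%N) (x 1%N) /\
  wedge (x 0%N) (y 1%N) =
    cf_num (upto ta 1 k ++ downto tb l 2) * wedge (x 0%N) (x 1%N).
Proof.
move=> k0 l0 hx hy hk hl.
(* The walk x_0, ..., x_k, y_l, ..., y_0 is put on one index: [Z k.+1] is y_l and [Z (k + l.+1)] is
   y_0, and [T j] is the tag at [Z j.+1]. The two continued fractions belong to the parts from x_1
   to y_0 and from x_0 to y_1. *)
pose Z j := if (j <= k)%N then x j else y (k + l.+1 - j)%N.
pose T j := if (j < k)%N then ta j.+1 else tb (k + l - j)%N.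
have ch : lchain (k + l) T Z.
  move=> j jkl; rewrite /Z /T.
  case: (ltngtP j.+1 k) => jk.
  - rewrite !ifT; try lia.
    by apply: (hx j.+1); rewrite jk.
  - have [jk'|jk'] : j = k \/ (k < j)%N by lia.
      rewrite ifT; last by lia.
      rewrite jk' (_ : k + l.+1 - k.+1 = l)%N; last by lia.
      rewrite (_ : k + l.+1 - k.+2 = l.-1)%N; last by lia.
      by rewrite (_ : k + l - k = l)%N; [rewrite addrC | lia].
    rewrite ifF; last by lia.
    rewrite addrC.
    have -> : (k + l.+1 - j.+1 = k + l - j)%N by lia.
    have -> : (k + l.+1 - j = (k + l - j).+1)%N by lia.
    have -> : (k + l.+1 - j.+2 = (k + l - j).-1)%N by lia.
    by apply: hy; lia.
  - rewrite ifT; last by lia.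
    rewrite (_ : k + l.+1 - j.+2 = l)%N; last by lia.
    by move: hk; rewrite -jk.
have Z01 : wedge (Z 0%N) (Z 1%N) = wedge (x 0%N) (x 1%N) by rewrite /Z /= k0.
split.
  pose cs := upto ta 2 k ++ downto tb l 1.
  have sz : size cs = (k + l).-1 by rewrite size_cat size_upto size_downto; lia.
  have ch1 : lchain (size cs) (nth 0 cs) (fun j => Z j.+1).
    move=> j; rewrite sz => jlt; rewrite (ch j.+1) //; last by lia.
    congr (_ *~ _); rewrite /cs /T nth_cat size_upto.
    case: ltnP => h; case: ltnP => h'; try lia.
      by rewrite nth_upto //; congr ta; lia.
    by rewrite nth_downto; [congr tb; lia|lia].
  have [e _] := lchain_cf ch1; move: e; rewrite sz.
  have -> : Z (k + l).-1.+2 = y 0%N.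
    by rewrite /Z leqNgt (_ : (k < _)%N) /=; [congr y; lia|lia].
  rewrite {1}/Z k0 => ->; congr (_ * _).
  by rewrite -Z01 (lchain_wedge ch (i := 1%N)) //; lia.
pose cs := upto ta 1 k ++ downto tb l 2.
have sz : size cs = (k + l).-1 by rewrite size_cat size_upto size_downto; lia.
have ch1 : lchain (size cs) (nth 0 cs) Z.
  move=> j; rewrite sz => jlt; rewrite (ch j) //; last by lia.
  congr (_ *~ _); rewrite /cs /T nth_cat size_upto.
  case: ltnP => h; case: ltnP => h'; try lia.
    by rewrite nth_upto.
  by rewrite nth_downto; [congr tb; lia|lia].
have [e _] := lchain_cf ch1; move: e; rewrite sz Z01.
have -> : Z (k + l).-1.+1 = y 1%N.
  by rewrite /Z leqNgt (_ : (k < _)%N) /=; [congr y; lia|lia].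
by [].
Qed.

Lemma wedge_basis (u v w : lattice) : wedge u v = 1 ->
  w = u *~ wedge w v + v *~ wedge u w.
Proof.
rewrite !pairMzE /wedge; case: u v w => [u1 u2] [v1 v2] [w1 w2] /= h.
apply: injective_projections => /=.
  transitivity (w1 * (u1 * v2 - u2 * v1)); last by ring.
  by rewrite h mulr1.
transitivity (w2 * (u1 * v2 - u2 * v1)); last by ring.
by rewrite h mulr1.
Qed.

(** * The chain of monomials along one side of the fan *)

Section Side.
Variables (cs : seq int) (X : nat -> lattice).
Local Notation n := (size cs).
Hypotheses (Xch : lchain n (nth 0 cs) X) (X0 : X 0%N = xi).

(** The first coordinates obey the recurrence of the Hirzebruch-Jung points and start from the same
    0, so they are proportional to them; comparing the ends, -r and r, gives the factor. *)
Lemma side_fst (r : nat) : all (fun c => 2 <= c) cs -> (0 < r)%N ->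
  cf_num cs = r -> (X n.+1).1 = - r%:Z -> (X 1%N).1 = - 1.
Proof.
move=> cs2 r0 cn Xl; pose G := hj_point cs.
have chG : chain n (nth 0 cs) (fun i => (G i).1) by apply: hj_chain_fst.
have chX : chain n (nth 0 cs) (fun i => (X i).1).
  by apply: (lchain_functional (L := fst)) Xch => // *; rewrite pairMzE /= mulrC.
have e i : (i <= n.+1)%N -> (X i).1 = (X 1%N).1 * (G i).1.
  elim/ltn_ind: i => -[|[|i]] IH i_n.
  - by rewrite X0 /G (hj0 cn) /= mulr0.
  - by rewrite /G hj1 /= mulr1.
  - have := chX i i_n; have := chG i i_n.
    rewrite (IH i.+1) // ?(ltnW i_n) // (IH i) //; last by lia.
    move=> h1 h2.
    have -> : (X i.+2).1 = nth 0 cs i * ((X 1%N).1 * (G i.+1).1) - (X 1%N).1 * (G i).1.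
      by rewrite -h2 addrC addKr.
    have -> : (G i.+2).1 = nth 0 cs i * (G i.+1).1 - (G i).1 by rewrite -h1 addrC addKr.
    by ring.
move: (e n.+1 (leqnn _)); rewrite Xl /G (hj_last r0 cs2 cn) /= => h.
have rz : r%:Z != 0 by lia.
by apply: (mulIf rz); rewrite -h mulN1r.
Qed.

Variable t : int.
Hypothesis X1 : X 1%N = (-1, t).

Lemma side_wedge i : (i <= n)%N -> wedge (X i) (X i.+1) = 1.
Proof. by move=> i_n; rewrite (lchain_wedge Xch) // X0 X1 /wedge /=; ring. Qed.

Lemma side_last : (X n.+1).1 = - cf_num cs /\ (X n.+1).2 = cf_num cs * t - cf_den cs.
Proof.
have [] := lchain_cf Xch; rewrite X0 X1 /wedge /= => h1 h2.
by split; lia.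
Qed.

(* The left-hand side is chart Q1 of X i in a fan with x_0 = X n.+1. *)
Lemma side_chart i : (i <= n.+1)%N ->
  (- (X i).1, (X n.+1).2 * (X i).1 + cf_num cs * (X i).2) = hj_point cs i.
Proof.
have [h1 h2] := side_last.
pose phi (m : lattice) : lattice := (- m.1, (X n.+1).2 * m.1 + cf_num cs * m.2).
have ch : lchain n (nth 0 cs) (fun i => phi (X i)).
  move=> j jn; have := Xch jn; rewrite pairMzE.
  move: (X j) (X j.+1) (X j.+2) => [u1 u2] [v1 v2] [w1 w2] [e1 e2].
  rewrite pairMzE /phi; apply: injective_projections => /=.
    by rewrite -opprD e1; ring.
  transitivity ((X n.+1).2 * (u1 + w1) + cf_num cs * (u2 + w2)); first by ring.
  by rewrite e1 e2; ring.
have e0 : phi (X 0%N) = hj_point cs 0.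
  by rewrite /phi X0 /hj_point chain_seq0 /=; congr pair; ring.
have e1 : phi (X 1%N) = hj_point cs 1.
  by rewrite /phi X1 hj1 h2 /=; congr pair; ring.
exact: (lchain_uniq ch (@hj_chain cs) e0 e1).
Qed.

(* This is where a_k, b_l >= 0 is used: it excludes x_1 = y_0. *)
Lemma side_convex : all (fun c => 2 <= c) cs -> 0 <= t ->
  forall i, (i <= n.+1)%N -> 1 <= (X i).2 - (X i).1.
Proof.
move=> cs2 t0 i i_n; pose L (m : lattice) := m.2 - m.1.
have ch : chain n (nth 0 cs) (fun i => L (X i)).
  apply: lchain_functional Xch; first by move=> u v; rewrite /L /=; ring.
  by move=> u d; rewrite /L pairMzE /=; ring.
have := chain_mono (cs_ge2 cs2) ch _ _ i_n.
by rewrite X0 X1 /L /= => H; apply: H; lia.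
Qed.
End Side.

(* The vectors (p, q) and (b, s) are primitive and parallel, hence equal up to the
   sign d; the lower bounds exclude d = -1. *)
Lemma fan_arith (r s p q a b p2 q2 : int) : 0 < r -> 0 < s -> 0 <= p ->
  r * q - a * p = 1 -> s * q2 - b * p2 = 1 -> 1 <= q + p -> 1 <= b + s -> 1 <= a + r ->
  p * s = q * b -> [/\ 0 <= a, 0 <= b & r * s - a * b = 1].
Proof.
move=> r0 s0 p0 h1 h2 h3 h4 h5 h6; pose d := r * s - a * b.
have dq : s = d * q.
  transitivity (s * (r * q - a * p)); first by rewrite h1 mulr1.
  transitivity (r * s * q - a * (p * s)); first by ring.
  by rewrite h6 /d; ring.
have dp : b = d * p.
  transitivity (b * (r * q - a * p)); first by rewrite h1 mulr1.
  transitivity (r * (q * b) - a * b * p); first by ring.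
  by rewrite -h6 /d; ring.
have du : d * (q * q2 - p * p2) = 1 by rewrite mulrBr !mulrA -dq -dp h2.
have d1 : d = 1.
  have [d1|d1] : d = 1 \/ d = -1.
    by have /eqP := congr1 absz du; rewrite abszM muln_eq1 => /andP[/eqP d1 _]; lia.
    by [].
  by rewrite d1 in dq dp; lia.
rewrite d1 mul1r in dq; rewrite d1 mul1r in dp.
split; rewrite -/d //; last by rewrite dp.
by nia.
Qed.

(** * Tents from chains *)

Lemma inv_exponent_to_lattice r alpha (w : lattice) :
  (exists2 n, inv_exponent r alpha n & to_lattice n = w) <->
  [/\ 0 <= w.1, 0 <= w.2 & exists t, alpha%:Z * w.1 + w.2 = r%:Z * t].
Proof.
split=> [[n nM <-] //|[h1 h2 h3]].
have e : to_lattice (absz2 w) = w.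
  by case: w h1 h2 {h3} => u v /= *; rewrite /to_lattice /= !gez0_abs.
by exists (absz2 w) => //; rewrite /inv_exponent e.
Qed.

(** The cone, through its chart, and the invariant exponents, through [to_lattice], have the same
    image [N] in the lattice; minimality is transported along these two injections. *)
Lemma minimal_generators_chart (r alpha : nat) (C : lattice -> Prop) (phi : lattice -> lattice)
    k (x : k.+1.-tuple lattice) (e : k.+1.-tuple (nat * nat)) :
  phi 0 = 0 -> (forall u v, phi (u + v) = phi u + phi v) -> injective phi ->
  (forall m, C m <-> (0 <= (phi m).1) && (0 <= (phi m).2)) ->
  (forall w, (exists m, phi m = w) <-> exists t, alpha%:Z * w.1 + w.2 = r%:Z * t) ->
  (forall i, phi (tnth x i) = to_lattice (tnth e i)) ->
  minimal_generators (inv_exponent r alpha) e -> minimal_generators C x.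
Proof.
move=> phi0 phiD phi_inj phiC phi_onto xe.
pose N w := exists2 n, inv_exponent r alpha n & to_lattice n = w.
rewrite (minimal_generators_map (erefl : to_lattice 0 = 0) to_latticeD to_lattice_inj (N := N)) //.
rewrite (_ : map to_lattice e = map phi x); last first.
  apply: (@eq_from_nth _ 0); rewrite !size_map !size_tuple // => i ik.
  rewrite !(nth_map 0) ?size_tuple //.
  by have := xe (Ordinal ik); rewrite !(tnth_nth 0).
have NC w : N w <-> exists2 m, C m & phi m = w.
  rewrite /N inv_exponent_to_lattice.
  split=> [[h1 h2 /phi_onto[m hm]]|[m /phiC/andP[h1 h2] <-]].
    by exists m => //; apply/phiC; rewrite hm h1 h2.
  by split=> //; apply/phi_onto; exists m.
exact: (proj2 (minimal_generators_map phi0 phiD phi_inj NC x)).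
Qed.

(** The image of the chart is cut out by a congruence modulo [r] in which only the residue of [a]
    counts, and that residue is the one of [alpha]. *)
Lemma chart1_onto (r a b s alpha : nat) u : (0 < r)%N -> a%:Z = alpha%:Z + r%:Z * u ->
  forall w, (exists m, chart r a b s Q1 m = w) <-> exists t, alpha%:Z * w.1 + w.2 = r%:Z * t.
Proof.
move=> r0 au [w1 w2] /=; split=> [[[m1 m2] /= [<- <-]]|[t e]].
  by exists (u * m1 + m2); rewrite au; ring.
exists (- w1, t + u * w1); rewrite /= au; congr pair; first by ring.
transitivity (r%:Z * t - alpha%:Z * w1); first by ring.
by rewrite -e; ring.
Qed.

Lemma chart3_onto (r a b s beta : nat) u : (0 < s)%N -> b%:Z = beta%:Z + s%:Z * u ->
  forall w, (exists m, chart r a b s Q3 m = w) <-> exists t, beta%:Z * w.1 + w.2 = s%:Z * t.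
Proof.
move=> r0 au [w1 w2] /=; split=> [[[m1 m2] /= [<- <-]]|[t e]].
  by exists (u * m2 + m1); rewrite au; ring.
exists (t + u * w1, - w1); rewrite /= au; congr pair; first by ring.
transitivity (s%:Z * t - beta%:Z * w1); first by ring.
by rewrite -e; ring.
Qed.

Section HJTuple.
Variables (r : nat) (cs : seq int) (k : nat) (e : k.+1.-tuple (nat * nat)).
Hypotheses (r0 : (0 < r)%N) (cs2 : all (fun c => 2 <= c) cs) (cn : cf_num cs = r).
Hypothesis (eE : e = hj_gens cs :> seq _).

Lemma hj_tuple_size : k = (size cs).+1.
Proof. by have := congr1 size eE; rewrite size_tuple size_hj_gens => -[]. Qed.

Lemma to_lattice_hj_tuple i : to_lattice (tnth e i) = hj_point cs (k - i).
Proof.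
have ks := hj_tuple_size; have ik : (i <= k)%N by rewrite -ltnS.
rewrite (tnth_nth 0) eE (nth_hj_gens r0 cs2 cn) -?ks //.
by rewrite (to_lattice_hj r0 cs2 cn) //; lia.
Qed.

Lemma hj_tuple_first i : (tnth e i).2 = 0%N <-> i = ord0.
Proof.
have ks := hj_tuple_size; have := congr1 snd (to_lattice_hj_tuple i) => /= h.
have ik : (i <= k)%N by rewrite -ltnS.
split=> [i0|->]; last first.
  have := congr1 snd (to_lattice_hj_tuple ord0).
  rewrite subn0 [X in hj_point cs X]ks (hj_last r0 cs2 cn) /=; lia.
apply: val_inj => /=; case: (posnP i) => // ipos.
have [] := hj_snd_step r0 cs2 cn (i := (k - i)%N); first by lia.
by rewrite -h i0; lia.
Qed.

Lemma hj_tuple_last i : (tnth e i).1 = 0%N <-> i = ord_max.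
Proof.
have ks := hj_tuple_size; have := congr1 fst (to_lattice_hj_tuple i) => /= h.
have ik : (i <= k)%N by rewrite -ltnS.
split=> [i0|->]; last first.
  have := congr1 fst (to_lattice_hj_tuple ord_max); rewrite /= subnn (hj0 cn) /=; lia.
apply: val_inj => /=; apply/eqP; rewrite eqn_leq ik leqNgt; apply/negP => ki.
have [] := hj_fst_step r0 cs2 cn (i := (k - i).-1); first by lia.
by rewrite prednK ?subn_gt0 // -h i0; lia.
Qed.
End HJTuple.

Lemma generates_multinom (V : nmodType) (M : V -> Prop) k (x : k.+1.-tuple V) m :
  minimal_generators M x -> M m -> exists c : 'X_{1..k.+1}, m = \sum_i tnth x i *+ c i.
Proof.
move=> [[_ h] _] /h[c ->]; exists [multinom c i | i < k.+1].
rewrite -(big_mkord xpredT (fun i => x`_i *+ c i)) size_tuple big_mkord.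
by apply: eq_bigr => i _; rewrite mnmE (tnth_nth 0).
Qed.

(** The reflection exchanging xi and eta. It turns the y side into a chain that starts at xi, so
    that the lemmas on one side serve for both, with orientation reversed. *)
Definition swap (m : lattice) : lattice := (m.2, m.1).

Lemma tent_of_chains (K : fieldType) (r s a b alpha beta : nat) (cs ds : seq int)
    (k l : nat) (e : k.+1.-tuple (nat * nat)) (f : l.+1.-tuple (nat * nat))
    (X Y : nat -> lattice) (t t' u u' : int) :
  fan_matrix r a b s -> (0 < r)%N -> (0 < s)%N ->
  all (fun c => 2 <= c) cs -> cf_num cs = r -> a%:Z = alpha%:Z + r%:Z * u ->
  all (fun c => 2 <= c) ds -> cf_num ds = s -> b%:Z = beta%:Z + s%:Z * u' ->
  e = hj_gens cs :> seq _ -> f = hj_gens ds :> seq _ ->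
  minimal_generators (inv_exponent r alpha) e ->
  minimal_generators (inv_exponent s beta) f ->
  lchain (size cs) (nth 0 cs) X -> X 0%N = xi -> X 1%N = (-1, t) -> (X k).2 = a ->
  lchain (size ds) (nth 0 ds) Y -> Y 0%N = xi -> Y 1%N = (-1, t') -> (Y l).2 = b ->
  tent_given_by_fan K e f r a b s.
Proof.
move=> rsab r0 s0 cs2 cn au ds2 dn bu eE fE eM fM Xch X0 X1 Xk Ych Y0 Y1 Yl.
have ks := hj_tuple_size eE; have ls := hj_tuple_size fE.
pose x : k.+1.-tuple lattice := [tuple X (k - i)%N | i < k.+1].
pose y : l.+1.-tuple lattice := [tuple swap (Y (l - i)%N) | i < l.+1].
have [Xk1 _] := side_last Xch X0 X1; have [Yl1 _] := side_last Ych Y0 Y1.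
rewrite -ks cn in Xk1; rewrite -ls dn in Yl1.
have cx i : chart r a b s Q1 (tnth x i) = to_lattice (tnth e i).
  rewrite (to_lattice_hj_tuple r0 cs2 cn eE) -(side_chart Xch X0 X1); last by lia.
  by rewrite -ks cn Xk tnth_mktuple.
have cy i : chart r a b s Q3 (tnth y i) = to_lattice (tnth f i).
  rewrite (to_lattice_hj_tuple s0 ds2 dn fE) -(side_chart Ych Y0 Y1); last by lia.
  by rewrite -ls dn Yl tnth_mktuple /= addrC.
have xM : minimal_generators (cone (fan_x0 r a) xi) x.
  apply: (minimal_generators_chart (phi := chart r a b s Q1)) cx eM.
  - exact: chart0. - exact: chartD. - exact: chart_inj.
  - by move=> m; rewrite -/(in_quad r a b s Q1 m) -quad_coneP.
  - exact: (chart1_onto _ _ r0 au).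
have yM : minimal_generators (cone (fan_y0 b s) eta) y.
  apply: (minimal_generators_chart (phi := chart r a b s Q3)) cy fM.
  - exact: chart0. - exact: chartD. - exact: chart_inj.
  - by move=> m; rewrite -/(in_quad r a b s Q3 m) -quad_coneP.
  - exact: (chart3_onto _ _ s0 bu).
have xn i : (i <= k)%N -> x`_i = X (k - i)%N.
  by move=> ik; have := tnth_nth 0 x (Ordinal (ik : (i < k.+1)%N)); rewrite tnth_mktuple => <-.
have yn i : (i <= l)%N -> y`_i = swap (Y (l - i)%N).
  by move=> il; have := tnth_nth 0 y (Ordinal (il : (i < l.+1)%N)); rewrite tnth_mktuple => <-.
have x_first : x`_0 = fan_x0 r a by rewrite xn // subn0 [LHS]surjective_pairing Xk1 Xk.
have x_last : x`_k = xi by rewrite xn // subnn X0.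
have y_first : y`_0 = fan_y0 b s by rewrite yn // subn0 /swap Yl1 Yl.
have y_last : y`_l = eta by rewrite yn // subnn Y0.
have fm : fan_monomials r a b s x y.
  split=> //; split=> //; apply/(sortedP 0) => i; rewrite size_tuple ltnS => ik /=.
    rewrite !xn ?(ltnW ik) // wedgeC (_ : (k - i = (k - i.+1).+1)%N); last by lia.
    by rewrite (side_wedge Xch X0 X1) //; lia.
  rewrite !yn ?(ltnW ik) // (_ : (l - i = (l - i.+1).+1)%N); last by lia.
  have := side_wedge Ych Y0 Y1 (i := (l - i.+1)%N); rewrite /wedge /swap /= => H.
  have := H (_ : (l - i.+1 <= size ds)%N); lia.
have xg m : in_quad r a b s Q1 m -> exists c : 'X_{1..k.+1}, m = \sum_i tnth x i *+ c i.
  by move=> /(quad_coneP rsab Q1) hm; apply: generates_multinom xM hm.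
have yg m : in_quad r a b s Q3 m -> exists c : 'X_{1..l.+1}, m = \sum_i tnth y i *+ c i.
  by move=> /(quad_coneP rsab Q3) hm; apply: generates_multinom yM hm.
have k0 : (0 < k)%N by lia.
have l0 : (0 < l)%N by lia.
have xf : tnth x ord0 = fan_x0 r a by rewrite (tnth_nth 0).
have xl : tnth x ord_max = xi by rewrite (tnth_nth 0).
have yf : tnth y ord0 = fan_y0 b s by rewrite (tnth_nth 0).
have yl : tnth y ord_max = eta by rewrite (tnth_nth 0).
have e1 := hj_tuple_first r0 cs2 cn eE; have e2 := hj_tuple_last r0 cs2 cn eE.
have f1 := hj_tuple_first s0 ds2 dn fE; have f2 := hj_tuple_last s0 ds2 dn fE.
have [A [pi [z [pi_surj pi0 fr piX piU]]]] := fan_presentation K rsab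
  (degree_surj rsab k0 l0 cx cy e1 e2 f1 f2 xg yg xf xl yf yl).
exists x, y, A, pi, z; split=> //.
- split=> // p.
  exact: (tent_idealP rsab k0 l0 cx cy e1 e2 f1 f2 xg yg xf xl yf yl pi0 piX).
- by move=> i; rewrite piU gens_x.
- by move=> i; rewrite piU gens_y.
Qed.

(** * From fans to continued fractions and back *)

Lemma fan_wedge r a b s : fan_matrix r a b s -> wedge (fan_x0 r a) (fan_y0 b s) = 1.
Proof. by rewrite /fan_matrix /wedge /= => <-; ring. Qed.

Lemma fan_tags_cf (r s a b : nat) : fan_matrix r a b s ->
   forall (k l : nat) (x : k.+1.-tuple lattice) (y : l.+1.-tuple lattice)
          (ta tb : nat -> int),
     fan_monomials r a b s x y -> fan_tags x y ta tb ->
     (ta 0%N = 0 -> cf_is_zero (upto ta 2 k ++ downto tb l 1)) /\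
     (tb 0%N = 0 -> cf_is_zero (upto ta 1 k ++ downto tb l 2)).
Proof.
move=> rsab k l x y ta tb [_ [x0 xk _] _ [y0 yl _]] [hx hy [h0 h0'] [hk hl]].
have w0 := fan_wedge rsab.
have k0 : (0 < k)%N.
  case: (posnP k) => // k0; move: xk; rewrite [X in _`_X]k0 x0 => -[].
  by move: rsab; rewrite /fan_matrix; lia.
have l0 : (0 < l)%N.
  case: (posnP l) => // l0; move: yl; rewrite [X in _`_X]l0 y0 => -[].
  by move: rsab; rewrite /fan_matrix; lia.
have [] := cycle_cf (x := nth 0 x) (y := nth 0 y) k0 l0 hx hy; rewrite ?xk ?yl //.
(* The corner relation x_1 + y_0 = a_0 x_0, paired with x_0, reduces this to the determinant of the
   fan matrix. *)
have -> : wedge x`_0 x`_1 = -1.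
  have := congr1 (wedge x`_0) h0; rewrite wedgeDr wedgeMzr wedgexx mulr0 x0 y0 w0; lia.
move=> e1 e2; rewrite /cf_is_zero; split=> t0.
  move: h0; rewrite t0 mulr0z => /eqP; rewrite addr_eq0 => /eqP h0; move: e1.
  have -> : wedge x`_1 y`_0 = 0 by rewrite h0 /wedge /=; ring.
  by lia.
move: h0'; rewrite t0 mulr0z => /eqP; rewrite addr_eq0 => /eqP h0'; move: e2.
have -> : wedge x`_0 y`_1 = 0 by rewrite h0' /wedge /=; ring.
by lia.
Qed.

Lemma point_injective (K : fieldType) (A : lmodType K) (I : eqType) (z : I -> A) :
  is_basis z -> injective z.
Proof.
move=> [free _] i j zij; apply/eqP/negP => /negP ij.
have u : uniq [:: i; j] by rewrite /= inE ij.
have := free _ (fun m => if m == i then 1 else -1) u.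
rewrite !big_cons big_nil eqxx [j == i]eq_sym (negbTE ij) zij scale1r scaleN1r addr0 subrr.
by move=> /(_ erefl i (mem_head _ _))/eqP; rewrite eqxx oner_eq0.
Qed.

Section Relations.
Variables (K : fieldType) (r a b s : nat).
Hypothesis rsab : fan_matrix r a b s.
Variables (A : comAlgType K) (z : lattice -> A).
Hypothesis zring : fan_ring r a b s z.

Lemma fan_pointM t m n : in_quad r a b s t m -> in_quad r a b s t n -> z m * z n = z (m + n).
Proof.
move=> hm hn; apply: (proj1 (zring.2 m n)); apply/(common_coneP rsab).
by exists t; rewrite hm hn.
Qed.

Lemma fan_pointMn t m n : in_quad r a b s t m -> z m ^+ n.+1 = z (m *+ n.+1).
Proof.
move=> hm; elim: n => [|n IH]; first by rewrite expr1.
by rewrite exprS IH (fan_pointM hm) ?in_quad_muln // -mulrS.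
Qed.

Variables (k N : nat) (w : k.+1.-tuple lattice) (d : k.+1.-tuple (nat * nat)).
Variables (var : 'I_k.+1 -> {mpoly K[N]}) (pi : {lrmorphism {mpoly K[N]} -> A}) (t : quadrant).
Hypothesis pi_var : forall i, pi (var i) = z (tnth w i).
Hypothesis w_in : forall i, in_quad r a b s t (tnth w i).
Hypothesis pi_ideal : forall q, quotient_ideal d q -> pi (q \mPo [tuple var i | i < k.+1]) = 0.

(* A relation between two exponents is a binomial equation of the quotient
   singularity, hence holds among the basis elements of the fan ring. *)
Lemma fan_relation (i0 i1 i2 : 'I_k.+1) n : (0 < n)%N ->
  tnth d i0 + tnth d i2 = tnth d i1 *+ n -> tnth w i0 + tnth w i2 = tnth w i1 *+ n.
Proof.
case: n => // n _ e; apply: (point_injective zring.1).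
rewrite -(fan_pointMn _ (w_in i1)) -(fan_pointM (w_in i0) (w_in i2)).
have := pi_ideal (q := 'X_i0 * 'X_i2 - 'X_i1 ^+ n.+1).
rewrite /quotient_ideal !rmorphB !rmorphM !rmorphXn /= !comp_mpolyXU -!tnth_nth !tnth_mktuple.
rewrite -monomialMn -monomialD e subrr => /(_ erefl).
by rewrite !pi_var => /eqP; rewrite subr_eq0 => /eqP.
Qed.
End Relations.

(** Consecutive Hirzebruch-Jung points satisfy the recurrence with positive coefficients, so each
    instance is an equation between monomials, and the hypothesis carries it over to [w]. *)
Lemma lchain_of_relations (r : nat) (cs : seq int) k (w : k.+1.-tuple lattice)
    (d : k.+1.-tuple (nat * nat)) :
  (0 < r)%N -> all (fun c => 2 <= c) cs -> cf_num cs = r -> d = hj_gens cs :> seq _ ->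
  (forall i0 i1 i2 n, (0 < n)%N -> tnth d i0 + tnth d i2 = tnth d i1 *+ n ->
    tnth w i0 + tnth w i2 = tnth w i1 *+ n) ->
  lchain (size cs) (nth 0 cs) (fun i => w`_(k - i)).
Proof.
move=> r0 cs2 cn dE h i i_n; have ks := hj_tuple_size dE.
pose j m : 'I_k.+1 := inord (k - m).
have jE m : j m = (k - m)%N :> nat by rewrite inordK //; lia.
have wj m : w`_(k - m) = tnth w (j m) by rewrite (tnth_nth 0) jE.
have dj m : (m <= k)%N -> to_lattice (tnth d (j m)) = hj_point cs m.
  by move=> mk; rewrite (to_lattice_hj_tuple r0 cs2 cn dE) jE subKn.
have c2 := cs_ge2 cs2 i_n; have cpos : 0 <= nth 0 cs i by lia.
rewrite !wj -(gez0_abs cpos) -pmulrn; apply: h; first by lia.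
apply: to_lattice_inj; rewrite to_latticeD to_latticeMn !dj; try lia.
by rewrite pmulrn gez0_abs // hj_chain.
Qed.

Lemma lchain_swap n c h : lchain n c h -> lchain n c (fun i => swap (h i)).
Proof.
move=> ch i i_n; have := ch i i_n; rewrite !pairMzE.
by move: (h i) (h i.+1) (h i.+2) => [? ?] [? ?] [? ?] [e1 e2]; rewrite /swap /= -e1 -e2.
Qed.

Lemma wedge_swap u v : wedge (swap u) (swap v) = - wedge u v.
Proof. rewrite /wedge /=; ring. Qed.

Lemma side_bound (r : nat) (cs : seq int) X t : (0 < r)%N ->
  all (fun c => 2 <= c) cs -> cf_num cs = r ->
  lchain (size cs) (nth 0 cs) X -> X 0%N = xi -> X 1%N = (-1, t) ->
  0 <= - (X (size cs)).1 < r%:Z.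
Proof.
move=> r0 cs2 cn ch X0 X1.
have := congr1 fst (side_chart ch X0 X1 (leqnSn (size cs))) => /= ->.
have [] := hj_fst_step r0 cs2 cn (leqnn (size cs)).
by rewrite (hj_last r0 cs2 cn) /= => -> ->.
Qed.

(** [t] is the corner tag. It is nonnegative because r t = a + q, where q >= 0 is the denominator of
    [cs]. *)
Lemma fan_side (r a : nat) (cs : seq int) X : (0 < r)%N ->
  all (fun c => 2 <= c) cs -> cf_num cs = r ->
  lchain (size cs) (nth 0 cs) X -> X 0%N = xi -> X (size cs).+1 = fan_x0 r a ->
  exists t, [/\ 0 <= t, X 1%N = (-1, t), 0 <= - (X (size cs)).1 < r%:Z
    & wedge (X (size cs)) (X (size cs).+1) = 1].
Proof.
move=> r0 cs2 cn ch X0 Xl.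
have X11 := side_fst ch X0 cs2 r0 cn (congr1 fst Xl).
have X1 : X 1%N = (-1, (X 1%N).2) by rewrite [LHS]surjective_pairing X11.
exists (X 1%N).2; split=> //.
- have [_] := side_last ch X0 X1; rewrite Xl cn /=.
  by have /andP[] := cf_den_lt_num cs2; nia.
- exact: side_bound cn ch X0 X1.
- exact: (side_wedge ch X0 X1 (leqnn (size cs))).
Qed.

Definition side_tags (cs : seq int) (k : nat) (t : int) (i : nat) : int :=
  if i == k then t else nth 0 cs (k - i.+1).

Lemma downto_side_tags cs k t : k = (size cs).+1 -> downto (side_tags cs k t) k.-1 1 = cs.
Proof.
move=> ks; apply: (@eq_from_nth _ 0); rewrite size_downto; first by rewrite ks subn1.
move=> i ik; rewrite nth_downto // /side_tags ifF; last by lia.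
by congr nth; lia.
Qed.

Lemma side_tagsP cs k t (w : nat -> lattice) : k = (size cs).+1 ->
  lchain (size cs) (nth 0 cs) (fun i => w (k - i)%N) ->
  forall i, (0 < i < k)%N -> w i.-1 + w i.+1 = w i *~ side_tags cs k t i.
Proof.
move=> ks ch i ik; have := ch (k - i.+1)%N; rewrite /side_tags ifF; last by lia.
rewrite addrC (_ : k - (k - i.+1) = i.+1)%N; last by lia.
rewrite (_ : k - (k - i.+1).+1 = i)%N; last by lia.
rewrite (_ : k - (k - i.+1).+2 = i.-1)%N; last by lia.
by apply; lia.
Qed.

Lemma cf_of_fan (K : fieldType) (r s a b : nat) (cs ds : seq int)
    (k l : nat) (e : k.+1.-tuple (nat * nat)) (f : l.+1.-tuple (nat * nat)) :
  fan_matrix r a b s -> (0 < r)%N -> (0 < s)%N ->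
  all (fun c => 2 <= c) cs -> cf_num cs = r -> e = hj_gens cs :> seq _ ->
  all (fun c => 2 <= c) ds -> cf_num ds = s -> f = hj_gens ds :> seq _ ->
  tent_given_by_fan K e f r a b s ->
  exists ta tb : nat -> int,
    [/\ downto ta k.-1 1 = cs, downto tb l.-1 1 = ds, 0 <= ta k /\ 0 <= tb l
      & cf_is_zero (upto ta 2 k ++ downto tb l 1) \/
        cf_is_zero (upto ta 1 k ++ downto tb l 2)].
Proof.
move=> rsab r0 s0 cs2 cn eE ds2 dn fE [x [y [A [pi [z [fm [_ pi0] fr pix piy]]]]]].
have ks := hj_tuple_size eE; have ls := hj_tuple_size fE.
have [[[xC _] _] [x0 xk _] [[yC _] _] [y0 yl _]] := fm.
have xch : lchain (size cs) (nth 0 cs) (fun i => x`_(k - i)).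
  apply: (lchain_of_relations r0 cs2 cn eE).
  apply: (fan_relation rsab fr (t := Q1) pix).
    by move=> i; apply/(quad_coneP rsab Q1)/xC/mem_tnth.
  by move=> q hq; apply/pi0/ideal_gen; constructor 1; exists q.
have ych : lchain (size ds) (nth 0 ds) (fun i => y`_(l - i)).
  apply: (lchain_of_relations s0 ds2 dn fE).
  apply: (fan_relation rsab fr (t := Q3) piy).
    by move=> i; apply/(quad_coneP rsab Q3)/yC/mem_tnth.
  by move=> q hq; apply/pi0/ideal_gen; constructor 2; exists q.
have [||t [t0 X1 xlt xw]] := fan_side (a := a) r0 cs2 cn xch.
- by rewrite subn0.
- by rewrite -ks subnn.
have [||t' [t0' Y1 ylt yw]] := fan_side (a := b) s0 ds2 dn (lchain_swap ych).
- by rewrite subn0 yl.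
- by rewrite -ls subnn y0.
move: X1 xlt xw Y1 ylt yw; rewrite -ks -ls !subn1 !subnn.
rewrite (_ : k - size cs = 1)%N; last by lia.
rewrite (_ : l - size ds = 1)%N; last by lia.
rewrite wedge_swap => X1 xlt xw Y1 ylt yw.
exists (side_tags cs k t), (side_tags ds l t').
have tk : side_tags cs k t k = t by rewrite /side_tags eqxx.
have tl : side_tags ds l t' l = t' by rewrite /side_tags eqxx.
rewrite !downto_side_tags // tk tl; split=> //.
have [||||||c1 c2] := cycle_cf (k := k) (l := l) (x := nth 0 x) (y := nth 0 y)
  (ta := side_tags cs k t) (tb := side_tags ds l t').
- by rewrite ks.
- by rewrite ls.
- exact: side_tagsP.
- exact: side_tagsP.
- by rewrite tk xk yl pairMzE X1 /=; congr pair; rewrite /=; ring.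
- rewrite tl xk yl pairMzE; move: Y1; case: (y`_l.-1) => u v [-> ->].
  by apply: injective_projections => /=; ring.
have w01 : wedge x`_0 x`_1 = -1 by rewrite wedgeC xw.
have w0 : wedge x`_0 y`_0 = 1 by rewrite x0 y0; apply: fan_wedge.
have rs : r%:Z * s%:Z = a%:Z * b%:Z + 1 by rewrite -rsab; ring.
rewrite w01 in c1 c2; rewrite /cf_is_zero.
(* x_1 and -y_0 have the same wedge with x_0, so x_1 = -y_0 + W x_0. The first coordinates of x_1
   and -y_0 are at most 0 and greater than -r, which is that of x_0, so W = 0. *)
case: (ltnP b r) => br; [left|right].
  have := congr1 fst (wedge_basis x`_1 w0); rewrite w01 !pairMzE /=.
  have -> : (x`_0).1 = - r%:Z by rewrite x0.
  have -> : (y`_0).1 = b by rewrite y0.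
  move=> e1; suff W0 : wedge x`_1 y`_0 = 0 by move: c1; rewrite W0; lia.
  by move: e1 xlt; move: (wedge _ _) => W -> /andP[? ?]; nia.
(* With b >= r, the equation rs = ab + 1 forces a < s, and the same argument on second coordinates
   gives y_1 = -x_0. *)
have as_ : (a < s)%N by nia.
have w10 : wedge y`_1 y`_0 = -1 by rewrite -yw opprK.
have := congr1 snd (wedge_basis y`_1 w0); rewrite w10 !pairMzE /=.
have -> : (x`_0).2 = a by rewrite x0.
have -> : (y`_0).2 = - s%:Z by rewrite y0.
move=> e1; suff W0 : wedge x`_0 y`_1 = 0 by move: c2; rewrite W0; lia.
by move: e1 ylt; rewrite /swap /=; move: (wedge _ _) => W -> /andP[? ?]; nia.
Qed.

Lemma fan_of_cf (K : fieldType) (r s alpha beta : nat) (ta tb : nat -> int)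
    (k l : nat) (e : k.+1.-tuple (nat * nat)) (f : l.+1.-tuple (nat * nat)) :
  (0 < r)%N -> (0 < s)%N ->
  all (fun c => 2 <= c) (downto ta k.-1 1) -> cf_num (downto ta k.-1 1) = r ->
  (exists t, cf_den (downto ta k.-1 1) + alpha%:Z = r%:Z * t) ->
  all (fun c => 2 <= c) (downto tb l.-1 1) -> cf_num (downto tb l.-1 1) = s ->
  (exists t, cf_den (downto tb l.-1 1) + beta%:Z = s%:Z * t) ->
  e = hj_gens (downto ta k.-1 1) :> seq _ -> f = hj_gens (downto tb l.-1 1) :> seq _ ->
  minimal_generators (inv_exponent r alpha) e ->
  minimal_generators (inv_exponent s beta) f ->
  0 <= ta k -> 0 <= tb l ->
  cf_is_zero (upto ta 2 k ++ downto tb l 1) \/ cf_is_zero (upto ta 1 k ++ downto tb l 2) ->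
  exists a b : nat, fan_matrix r a b s /\ tent_given_by_fan K e f r a b s.
Proof.
set cs := downto ta _ _; set ds := downto tb _ _.
move=> r0 s0 cs2 cn [u hu] ds2 dn [u' hu'] eE fE eM fM t0 t0' zero.
have ks := hj_tuple_size eE; have ls := hj_tuple_size fE.
(* The second entries are dictated by the corner tags: x_(k-1) = a_k xi - eta is [(-1, ta k)], and
   likewise on the y side after the reflection. *)
pose X := nth 0 (chain_seq xi (-1, ta k) cs).
pose Y := nth 0 (chain_seq xi (-1, tb l) ds).
have Xch : lchain (size cs) (nth 0 cs) X by apply: chain_seqP.
have Ych : lchain (size ds) (nth 0 ds) Y by apply: chain_seqP.
have X0 : X 0%N = xi by apply: chain_seq0.
have Y0 : Y 0%N = xi by apply: chain_seq0.
have X1 : X 1%N = (-1, ta k) by apply: chain_seq1.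
have Y1 : Y 1%N = (-1, tb l) by apply: chain_seq1.
have [Xl1 Xl2] := side_last Xch X0 X1; have [Yl1 Yl2] := side_last Ych Y0 Y1.
rewrite -ks cn in Xl1 Xl2; rewrite -ls dn in Yl1 Yl2.
have /andP[p0 _] := side_bound r0 cs2 cn Xch X0 X1.
have /andP[p20 _] := side_bound s0 ds2 dn Ych Y0 Y1.
have xw : wedge (X (size cs)) (X k) = 1.
  by rewrite [in X k]ks; exact: (side_wedge Xch X0 X1 (leqnn (size cs))).
have yw : wedge (Y (size ds)) (Y l) = 1.
  by rewrite [in Y l]ls; exact: (side_wedge Ych Y0 Y1 (leqnn (size ds))).
have Xc i : (i <= k)%N -> 1 <= (X i).2 - (X i).1.
  by move=> ik; apply: (side_convex Xch X0 X1 cs2 t0); rewrite -ks.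
have Yc i : (i <= l)%N -> 1 <= (Y i).2 - (Y i).1.
  by move=> il; apply: (side_convex Ych Y0 Y1 ds2 t0'); rewrite -ls.
have csn j : (j < size cs)%N -> nth 0 cs j = ta (k.-1 - j)%N.
  by rewrite size_downto => jn; rewrite nth_downto.
have dsn j : (j < size ds)%N -> nth 0 ds j = tb (l.-1 - j)%N.
  by rewrite size_downto => jn; rewrite nth_downto.
have [||||||c1 c2] := cycle_cf (k := k) (l := l) (x := fun i => X (k - i)%N)
  (y := fun i => swap (Y (l - i)%N)) (ta := ta) (tb := tb).
- by rewrite ks.
- by rewrite ls.
- move=> i ik; have := Xch (k - i.+1)%N; rewrite csn; last by lia.
  rewrite (_ : (k - i.+1).+2 = k - i.-1)%N; last by lia.
  rewrite (_ : (k - i.+1).+1 = k - i)%N; last by lia.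
  by rewrite (_ : k.-1 - (k - i.+1) = i)%N 1?addrC; [apply; lia|lia].
- move=> i ik; have := lchain_swap Ych (i := (l - i.+1)%N); rewrite dsn; last by lia.
  rewrite (_ : (l - i.+1).+2 = l - i.-1)%N; last by lia.
  rewrite (_ : (l - i.+1).+1 = l - i)%N; last by lia.
  by rewrite (_ : l.-1 - (l - i.+1) = i)%N 1?addrC; [apply; lia|lia].
- rewrite !subnn (_ : k - k.-1 = 1)%N; last by lia.
  by rewrite X0 X1 Y0 pairMzE; apply: injective_projections => /=; ring.
- rewrite !subnn (_ : l - l.-1 = 1)%N; last by lia.
  by rewrite X0 Y1 Y0 pairMzE; apply: injective_projections => /=; ring.
rewrite !subn0 (_ : k - 1 = size cs)%N in c1 c2; last by lia.
rewrite (_ : l - 1 = size ds)%N in c1 c2; last by lia.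
have [a0 b0 rsab] : [/\ 0 <= (X k).2, 0 <= (Y l).2 & r%:Z * s%:Z - (X k).2 * (Y l).2 = 1].
  have rpos : 0 < r%:Z by [].
  have spos : 0 < s%:Z by [].
  have hx : r%:Z * (X (size cs)).2 - (X k).2 * (- (X (size cs)).1) = 1.
    by rewrite -[RHS]xw /wedge Xl1; ring.
  have hy : s%:Z * (Y (size ds)).2 - (Y l).2 * (- (Y (size ds)).1) = 1.
    by rewrite -[RHS]yw /wedge Yl1; ring.
  have x1 : 1 <= (X (size cs)).2 + (- (X (size cs)).1) by apply: Xc; lia.
  have y1 : 1 <= (Y (size ds)).2 + (- (Y (size ds)).1) by apply: Yc; lia.
  have x2 : 1 <= (X k).2 + r%:Z by have := Xc k (leqnn k); rewrite Xl1; lia.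
  have y2 : 1 <= (Y l).2 + s%:Z by have := Yc l (leqnn l); rewrite Yl1; lia.
  (* The vanishing numerator makes x_1 parallel to y_0, or x_0 parallel to y_1; the second case is
     the first with the two sides exchanged. *)
  case: zero; rewrite /cf_is_zero => z0.
    apply: (fan_arith rpos spos p0 hx hy x1 y2 x2).
    by move: c1; rewrite z0 mul0r /wedge /swap /= Yl1; lia.
  have [|? ? h] := fan_arith spos rpos p20 hy hx y1 x2 y2.
    by move: c2; rewrite z0 mul0r /wedge /swap /= Xl1; lia.
  by split=> //; rewrite -h; ring.
exists `|(X k).2|%N, `|(Y l).2|%N.
have fm : fan_matrix r `|(X k).2| `|(Y l).2| s by rewrite /fan_matrix !gez0_abs.
split=> //.
(* With q the denominator, a = r a_k - q and q + alpha = r u, so a = alpha + r (a_k - u); likewise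
   for b and beta. *)
apply: (tent_of_chains K (u := ta k - u) (u' := tb l - u') fm r0 s0 cs2 cn _ ds2 dn _ eE fE eM fM
  Xch X0 X1 _ Ych Y0 Y1 _); rewrite gez0_abs //.
- by rewrite Xl2 mulrBr -hu; ring.
- by rewrite Yl2 mulrBr -hu'; ring.
Qed.

Theorem corollary2p8 :
  (forall (r s a b : nat), fan_matrix r a b s ->
   forall (k l : nat) (x : k.+1.-tuple lattice) (y : l.+1.-tuple lattice)
          (ta tb : nat -> int),
     fan_monomials r a b s x y -> fan_tags x y ta tb ->
     (ta 0%N = 0 -> tb 0%N < 0 -> cf_is_zero (upto ta 2 k ++ downto tb l 1)) /\
     (ta 0%N < 0 -> tb 0%N = 0 -> cf_is_zero (upto ta 1 k ++ downto tb l 2)))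
  /\
  (forall (K : fieldType) (r s alpha beta : nat) (eps eps' : K),
     cyclic_quotient_type r alpha -> cyclic_quotient_type s beta ->
     r.-primitive_root eps -> s.-primitive_root eps' ->
   forall (k l : nat)
          (e : k.+1.-tuple (nat * nat)) (f : l.+1.-tuple (nat * nat)),
     quotient_generators r alpha eps e -> quotient_generators s beta eps' f ->
     ((exists a b : nat,
         fan_matrix r a b s /\ tent_given_by_fan K e f r a b s)
      <->
      (exists ta tb : nat -> int,
         [/\ cf_expansion r (r - alpha) (downto ta k.-1 1),
             cf_expansion s (s - beta) (downto tb l.-1 1),
             0 <= ta k /\ 0 <= tb l
           & cf_is_zero (upto ta 2 k ++ downto tb l 1) \/
             cf_is_zero (upto ta 1 k ++ downto tb l 2)]))).
Proof.
split=> [r s a b rsab k l x y ta tb fm ft|].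
  have [h1 h2] := fan_tags_cf rsab fm ft.
  by split=> [ta0 _|_ tb0]; [apply: h1|apply: h2].
move=> K r s alpha beta eps eps' ct ct' prim prim' k l e f qe qf.
have r0 : (0 < r)%N by case: ct.
have s0 : (0 < s)%N by case: ct'.
split=> [[a [b [rsab tent]]]|[ta [tb [ea eb [ak bl] zero]]]].
  have [cs ecs] := cf_expansion_exists ct; have [ds eds] := cf_expansion_exists ct'.
  have [cs2 cn cd] := cf_expansionP ct ecs; have [ds2 dn dd] := cf_expansionP ct' eds.
  have eE := quotient_generatorsE prim r0 cs2 cn cd qe.
  have fE := quotient_generatorsE prim' s0 ds2 dn dd qf.
  have [ta [tb [ea eb h zero]]] := cf_of_fan rsab r0 s0 cs2 cn eE ds2 dn fE tent.
  by exists ta, tb; rewrite ea eb.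
have [cs2 cn cd] := cf_expansionP ct ea; have [ds2 dn dd] := cf_expansionP ct' eb.
have eE := quotient_generatorsE prim r0 cs2 cn cd qe.
have fE := quotient_generatorsE prim' s0 ds2 dn dd qf.
exact: (fan_of_cf K r0 s0 cs2 cn cd ds2 dn dd eE fE
  (quotient_generators_min prim qe) (quotient_generators_min prim' qf) ak bl zero).
Qed.
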